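(* Let $X$ be a compact metrizable space, and suppose $O_X$ is dense in $X$. Let $C=C_X$. In each of the following cases $\tau_{k|C}=\tau_k$, and the compact-open topology $\tau_k$ on $H(X)$ is minimal: (a) $C$ is zero-dimensional, $X\setminus S_X$ has only finitely many components, and $S_X$ has at most one limit point in $C$; or (b) $C$ is a convergent sequence and $S_X$ has at most one limit point in $C$.
   Context: $H(X)$ denotes the group of all homeomorphisms of $X$ onto itself under composition, and $\tau_k$ is the compact-open topology on $H(X)$. A topology on a group is a group topology if the group operations are continuous for it. A Hausdorff group topology on a group is minimal if no strictly coarser group topology on the group is Hausdorff. $O_X=\{x\in X: x \text{ has a neighborhood homeomorphic to } (0,1)\}$; $C_X=X\setminus O_X$; $S_X$ is the set of all points of $X$ with a clopen neighborhood homeomorphic to the circle $S^1$. ''$S_X$ has at most one limit point in $C$'' means $|\overline{S_X}\cap C|\le 1$. ''Convergent sequence'' means a (non-trivial) convergent sequence together with its unique limit point, i.e. a space homeomorphic to $\{0\}\cup\{1/n:n\ge1\}$. For a closed set $C\subseteq X$, a compatible metric $d$ on $X$ and $\epsilon>0$, let $C_\epsilon=\{x\in X: d(x,C)<\epsilon\}$ (with $C_\epsilon=\emptyset$ if $C=\emptyset$), and $$B_\epsilon^{\tau_{k|C}}=\{h\in H(X): d(h(x),x)<\epsilon \text{ and } d(h^{-1}(x),x)<\epsilon \text{ for all } x\in X\setminus C_\epsilon\}.$$ $\tau_{k|C}$ is the collection of all unions of translates $gB_\epsilon^{\tau_{k|C}}$ ($g\in H(X)$, $\epsilon>0$). It does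 not depend on the choice of compatible metric $d$. *)

(* Defs.v *)
From HB Require Import structures.
From mathcomp Require Import all_boot all_order all_algebra.
From mathcomp Require Import all_classical all_reals all_analysis.
Import Order.TTheory GRing.Theory Num.Theory.
Import numFieldNormedType.Exports.

Set Implicit Arguments.
Unset Strict Implicit.
Unset Printing Implicit Defensive.

Local Open Scope classical_set_scope.
Local Open Scope ring_scope.

Definition is_topology (T : Type) (tau : set (set T)) : Prop :=
  [/\ tau setT,
      forall A B, tau A -> tau B -> tau (A `&` B) &
      forall F : set (set T), F `<=` tau -> tau (\bigcup_(A in F) A)].

Definition hausdorff_topology (T : Type) (tau : set (set T)) : Prop :=
  forall x y : T, x <> y ->
    exists A B, [/\ tau A, tau B, A x, B y & A `&` B = set0].

(* The first clause after [is_topology] is continuity of multiplication for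
   the product topology, the second one continuity of the inverse. *)
Definition group_topology (G : groupType) (tau : set (set G)) : Prop :=
  [/\ is_topology tau,
      forall (x y : G) W, tau W -> W (x * y)%g ->
        exists U V, [/\ tau U, tau V, U x, V y &
                        forall u v, U u -> V v -> W (u * v)%g] &
      forall W, tau W -> tau [set x : G | W (x^-1)%g]].

Definition minimal_group_topology (G : groupType) (tau : set (set G)) : Prop :=
  [/\ group_topology tau, hausdorff_topology tau &
      forall sigma : set (set G), sigma `<` tau -> group_topology sigma ->
        ~ hausdorff_topology sigma].

Definition homeomorphic (X Y : topologicalType) : Prop :=
  exists (f : X -> Y) (g : Y -> X),
    [/\ continuous f, continuous g, cancel f g & cancel g f].

Record homeo (X : topologicalType) : Type := Homeo {
  homeo_fun :> X -> X ;
  homeo_inv : X -> X ;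
  homeo_fun_cont : continuous homeo_fun ;
  homeo_inv_cont : continuous homeo_inv ;
  homeo_funK : cancel homeo_fun homeo_inv ;
  homeo_invK : cancel homeo_inv homeo_fun }.

Section HomeoGroup.
Variable X : topologicalType.
Implicit Types f g h : homeo X.

HB.instance Definition _ := gen_eqMixin (homeo X).
HB.instance Definition _ := gen_choiceMixin (homeo X).

Lemma homeo_ext f g : homeo_fun f =1 homeo_fun g -> f = g.
Proof.
case: f g => [f f' cf cf' fK f'K] [g g' cg cg' gK g'K] /= /funext fg.
subst g; have f'g' : f' = g'.
  by apply/funext => x; apply: (can_inj fK); rewrite f'K g'K.
by subst g'; congr Homeo; exact: Prop_irrelevance.
Qed.

Definition homeo1 : homeo X :=
  @Homeo X idfun idfun (fun x => cvg_id) (fun x => cvg_id) (fun=> erefl) (fun=> erefl).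

Definition homeoV f : homeo X :=
  Homeo (@homeo_inv_cont _ f) (@homeo_fun_cont _ f)
        (@homeo_invK _ f) (@homeo_funK _ f).

Definition homeoM f g : homeo X :=
  @Homeo X (homeo_fun f \o homeo_fun g) (homeo_inv g \o homeo_inv f)
    (fun x => continuous_comp (@homeo_fun_cont _ g x) (@homeo_fun_cont _ f _))
    (fun x => continuous_comp (@homeo_inv_cont _ f x) (@homeo_inv_cont _ g _))
    (can_comp (@homeo_funK _ f) (@homeo_funK _ g))
    (can_comp (@homeo_invK _ g) (@homeo_invK _ f)).

Lemma homeoMA : associative homeoM.
Proof. by move=> f g h; exact: homeo_ext. Qed.

Lemma homeo1M : left_id homeo1 homeoM.
Proof. by move=> f; exact: homeo_ext. Qed.

Lemma homeoM1 : right_id homeo1 homeoM.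
Proof. by move=> f; exact: homeo_ext. Qed.

Lemma homeoVM : left_inverse homeo1 homeoV homeoM.
Proof. by move=> f; apply: homeo_ext => x; exact: homeo_funK. Qed.

Lemma homeoMV : right_inverse homeo1 homeoV homeoM.
Proof. by move=> f; apply: homeo_ext => x; exact: homeo_invK. Qed.

HB.instance Definition _ :=
  isGroup.Build (homeo X) homeoMA homeo1M homeoM1 homeoVM homeoMV.

End HomeoGroup.

(* The trace on [homeo X] of the compact-open topology on all maps [X -> X]. *)
Definition tau_k (X : topologicalType) : set (set (homeo X)) :=
  [set U | exists2 V : set {compact-open, X -> X},
             open V & U = @homeo_fun X @^-1` V].
Arguments tau_k : clear implicits.

Definition compatible_metric (R : realType) (X : topologicalType)
    (d : X -> X -> R) : Prop :=
  [/\ forall x y, d x y = 0 <-> x = y,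
      forall x y, d x y = d y x,
      forall x y z, d x z <= d x y + d y z &
      forall x, nbhs x = filter_from [set e | 0 < e]
                                     (fun e => [set y | d x y < e])].

Definition metrizable (R : realType) (X : topologicalType) : Prop :=
  exists d : X -> X -> R, compatible_metric d.

(* [d(x, C)] is an infimum of extended reals: it is [+oo] when [C] is empty,
   so that the neighbourhood below is then empty. *)
Definition set_dist (R : realType) (X : Type) (d : X -> X -> R)
    (C : set X) (x : X) : \bar R :=
  ereal_inf [set (d x c)%:E | c in C].

Definition metric_nbhd (R : realType) (X : Type) (d : X -> X -> R)
    (C : set X) (e : R) : set X :=
  [set x | (set_dist d C x < e%:E)%E].

Definition B_kC (R : realType) (X : topologicalType) (d : X -> X -> R)
    (C : set X) (e : R) : set (homeo X) :=
  [set h : homeo X | forall x, ~ metric_nbhd d C e x ->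
             d (h x) x < e /\ d ((h^-1)%g x) x < e].

Definition tau_kC (R : realType) (X : topologicalType) (d : X -> X -> R)
    (C : set X) : set (set (homeo X)) :=
  [set U | exists2 F : set (set (homeo X)),
     F `<=` [set A | exists (g : homeo X) (e : R),
               0 < e /\ A = [set (g * h)%g | h in B_kC d C e]] &
     U = \bigcup_(A in F) A].

Definition unit_circle (R : realType) : set (R * R) :=
  [set p | p.1 ^+ 2 + p.2 ^+ 2 = 1].
Arguments unit_circle : clear implicits.

(* In the definitions below, a set used as a space is the sigma type
   [set_type] with the subspace topology. *)
Definition arc_points (R : realType) (X : topologicalType) : set X :=
  [set x | exists2 N : set X,
             nbhs x N & homeomorphic N [set t : R | 0 < t < 1]].
Arguments arc_points : clear implicits.

Definition circle_points (R : realType) (X : topologicalType) : set X :=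
  [set x | exists N : set X,
             [/\ clopen N, N x & homeomorphic N (unit_circle R)]].
Arguments circle_points : clear implicits.

(* Existence of a base of clopen sets. The library's [zero_dimensional] only
   asks that points be separated by clopen sets. *)
Definition clopen_base (Y : topologicalType) : Prop :=
  forall (y : Y) (U : set Y), nbhs y U ->
    exists V : set Y, [/\ clopen V, V y & V `<=` U].

Definition components (X : topologicalType) (A : set X) : set (set X) :=
  [set connected_component A x | x in A].

Definition convergent_sequence (R : realType) (Y : topologicalType) : Prop :=
  homeomorphic Y ([set 0 : R] `|` [set n.+1%:R^-1 | n in [set: nat]]).

(* Main.v *)
Require Import Defs.
From HB Require Import structures.
From mathcomp Require Import all_boot all_order all_algebra.
From mathcomp Require Import all_classical all_reals all_analysis.
From mathcomp Require Import ring lra.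
Import Order.TTheory GRing.Theory Num.Theory.
Import numFieldNormedType.Exports.
Local Open Scope classical_set_scope.
Local Open Scope ring_scope.

(** Write O for the set of arc points, C for its complement and S for the union
   of the clopen circles.  The proof has two halves, joined by one uniform
   estimate on homeomorphisms.

   First half: every Hausdorff group topology sigma coarser than the
   compact-open topology still contains, around the identity, sets inside each
   [B_kC d C e] ([B_kC_nbhs1]).  Take two non-commuting homeomorphisms f and g
   supported in one small arc.  If h moves this arc off itself, then the
   conjugate of f by h commutes with g; and not to commute is an open condition
   on h for sigma.  So the h that are sigma-close to the identity satisfy: the
   arc meets its image ([chart_meets_image]).  For three consecutive arcs
   around a point x of O this forces the points near x to stay near x
   ([chart_three_points]); the middle arc rules out that the image runs around
   the other side of a circle.  What lies at distance at least e from C is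
   compact and contained in O, so finitely many points x suffice.

   Second half: under either hypothesis, a homeomorphism that is close to the
   identity away from C is uniformly close to the identity
   ([uniform_of_separated]).  By compactness it is enough that no point near x
   is sent near y, for distinct points x and y of C.  Points of S do no harm,
   as they accumulate at one point of C at most.  For the others, let A be a
   part of C that is clopen in C and contains x but not y.  A thin shell around
   A is far from C, so it is hardly moved; hence the points near A that are
   sent away from A form a clopen set Q that stays near A ([barrier]).

   - If there are finitely many components off S, then the component of x is a
     neighbourhood of x and is not confined near x, whereas Q contains any
     component that it meets ([separated_component]).
   - If C is a convergent sequence, then x or y is isolated in C, say x, and
     A = [set x].  Either Q misses C, so that it is a compact one-dimensional
     manifold and consists of circles, or Q contains x, which leads to a
     contradiction as well ([separated_isolated]).

   The classification of compact one-dimensional manifolds used in the second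
   case is [clopen_arc_points_circle].  Starting in a chart one follows the
   manifold along injective curves, the rays.  These curves are open and nested,
   and their union is closed up to the starting point; if none of them returned,
   then by compactness a single one would cover everything, including its own
   end.  So some ray returns, and closes up to a clopen loop.

   The uniform estimate says that the sets [B_kC d C e] and the uniform balls
   form the same neighbourhoods of the identity.  With the second half, this
   gives the equality of the two topologies ([tau_kC_eq]); with the first half,
   it gives minimality ([tau_k_minimal]). *)

Set Implicit Arguments.
Unset Strict Implicit.
Unset Printing Implicit Defensive.

(** * Metrics on compact spaces *)

Section Metric.
Context {R : realType} {X : topologicalType} {d : X -> X -> R}.
Hypothesis md : compatible_metric d.

Lemma metric_refl x : d x x = 0.
Proof. by case: md => + _ _ _; move=> /(_ x x) [_ ->]. Qed.

Lemma metric_eq0 x y : d x y = 0 -> x = y.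
Proof. by case: md => + _ _ _; move=> /(_ x y) [+ _]. Qed.

Lemma metric_sym x y : d x y = d y x.
Proof. by case: md. Qed.

Lemma metric_tri y x z : d x z <= d x y + d y z.
Proof. by case: md. Qed.

Lemma metric_ge0 x y : 0 <= d x y.
Proof.
have := metric_tri y x x; rewrite metric_refl (metric_sym y x); lra.
Qed.

Lemma metric_gt0 x y : x <> y -> 0 < d x y.
Proof.
move=> xy; rewrite lt_neqAle metric_ge0 andbT eq_sym.
by apply/eqP => /metric_eq0.
Qed.

Lemma nbhs_metric x (U : set X) :
  nbhs x U <-> exists2 e, 0 < e & forall y, d x y < e -> U y.
Proof.
have -> : nbhs x = filter_from [set e | 0 < e] (fun e => [set y | d x y < e]).
  by case: md.
by [].
Qed.

Lemma nbhs_metric_ball x e : 0 < e -> nbhs x [set y | d x y < e].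
Proof. by move=> e0; apply/nbhs_metric; exists e. Qed.

Lemma open_metric (U : set X) :
  (forall x, U x -> exists2 e, 0 < e & forall y, d x y < e -> U y) -> open U.
Proof. by rewrite openE => oU x /oU /nbhs_metric. Qed.

Lemma open_near_set (A : set X) e : open [set x | exists2 a, A a & d x a < e].
Proof.
apply: open_metric => x [a Aa xa]; exists (e - d x a); first lra.
move=> y xy; exists a => //.
by have := metric_tri x y a; rewrite (metric_sym y x); lra.
Qed.

Lemma metric_hausdorff : hausdorff_space X.
Proof.
move=> x y clxy; apply: contrapT => /metric_gt0 xy.
have e0 : 0 < d x y / 2 by lra.
have [z /= [xz yz]] := clxy _ _ (nbhs_metric_ball x e0) (nbhs_metric_ball y e0).
by have := metric_tri z x y; rewrite (metric_sym z y); lra.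
Qed.

Lemma metric_nbhdP (C : set X) e x :
  metric_nbhd d C e x <-> exists2 c, C c & d x c < e.
Proof.
rewrite /metric_nbhd /set_dist /=; split.
  by move=> /ereal_inf_lt [_ [c Cc <-]]; rewrite lte_fin => ?; exists c.
move=> [c Cc xc]; apply: (@le_lt_trans _ _ (d x c)%:E); last by rewrite lte_fin.
by apply: ereal_inf_lbound; exists c.
Qed.

Lemma continuous_metric (f : X -> X) x e : continuous f -> 0 < e ->
  exists2 r, 0 < r & forall y, d x y < r -> d (f x) (f y) < e.
Proof. by move=> /(_ x _ (nbhs_metric_ball (f x) _))/[apply] /nbhs_metric. Qed.

Lemma closed_le_dist x e : closed [set y | d x y <= e].
Proof.
rewrite -openC; apply: open_metric => y /= /negP; rewrite -ltNge => exy.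
exists (d x y - e); first lra.
move=> z yz; apply/negP; rewrite -ltNge.
by have := metric_tri z x y; rewrite (metric_sym z y); lra.
Qed.

(** The local radii have a common positive lower bound.  Applied to properties
   of a point that quantify over a second point, this yields uniform continuity
   and positive distances between sets. *)
Lemma compact_radius (K : set X) (P : R -> X -> Prop) : compact K ->
  (forall (r s : R) x, 0 < r -> r <= s -> P s x -> P r x) ->
  (forall x, K x -> exists2 r, 0 < r & forall y, d x y < r -> K y -> P r y) ->
  exists2 r, 0 < r & forall x, K x -> P r x.
Proof.
move=> /compact_near_coveringP /near_covering_withinP cK mono loc.
have : \forall r \near (0 : R)^'+, K `<=` P r.
  apply: cK => x /loc [r r0 xP].
  exists ([set y | d x y < r], [set s | 0 < s <= r]) => /=.
    split; first exact: nbhs_metric_ball.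
    by near=> s; apply/andP; split; near: s;
      [exact: nbhs_right_gt|exact: nbhs_right_le].
  by move=> [y s] /= [xy /andP[s0 sr]] Ky; apply: mono s0 sr _; exact: xP.
move=> KP; near (0 : R)^'+ => r; exists r => //.
by near: r.
Unshelve. all: by end_near. Qed.

Lemma separation_radius (K F : set X) : compact K -> closed F ->
  K `&` F = set0 ->
  exists2 r, 0 < r & forall x y, K x -> F y -> r <= d x y.
Proof.
move=> cK cF KF.
have [||r r0 rP] := compact_radius (P := fun r x => forall y, F y -> r <= d x y) cK.
- by move=> r s x r0 rs sP y /sP; lra.
- move=> x Kx; have /nbhs_metric [e e0 eP] : nbhs x (~` F).
    by apply: open_nbhs_nbhs; split; [exact: closed_openC|
      move=> Fx; rewrite -[False]/(set0 x) -KF].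
  exists (e / 2); first lra.
  move=> y xy Ky z Fz; have : ~ d x z < e by move=> /eP.
  by move=> /negP; rewrite -leNgt; have := metric_tri y x z; lra.
by exists r => // x y /rP; apply.
Qed.

Hypothesis cX : compact [set: X].

Lemma closed_compactX (K : set X) : closed K -> compact K.
Proof. by move=> cK; exact: (subclosed_compact cK cX). Qed.

Lemma uniformly_continuous (f : X -> X) e : continuous f -> 0 < e ->
  exists2 r, 0 < r & forall x y, d x y < r -> d (f x) (f y) < e.
Proof.
move=> cf e0.
have [||r r0 rP] := compact_radius
  (P := fun r x => forall y, d x y < r -> d (f x) (f y) < e) cX.
- by move=> r s x r0 rs sP y xy; apply: sP; lra.
- move=> x _; have e20 : 0 < e / 2 by lra.
  have [r r0 rP] := continuous_metric x cf e20.
  exists (r / 2) => [|y xy _ z yz]; first lra.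
  have xr : d x y < r by lra.
  have zr : d x z < r by have := metric_tri y x z; lra.
  have := rP _ xr; have := rP _ zr; have := metric_tri (f x) (f y) (f z).
  by rewrite (metric_sym (f y) (f x)); lra.
by exists r => // x y; exact: rP.
Qed.

End Metric.

(** * The compact-open topology on a homeomorphism group *)

Section CompactOpen.
Context {R : realType} {X : topologicalType} {d : X -> X -> R}.
Hypothesis md : compatible_metric d.
Hypothesis cX : compact [set: X].
Implicit Types (f g h : homeo X) (U W : set (homeo X)).

Lemma homeoME g h x : (g * h)%g x = g (h x).
Proof. by []. Qed.

Lemma homeoVK g x : (g^-1)%g (g x) = x.
Proof. exact: homeo_funK. Qed.

Lemma homeoKV g x : g ((g^-1)%g x) = x.
Proof. exact: homeo_invK. Qed.

Lemma homeo_inj g : injective g.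
Proof. exact: can_inj (homeoVK g). Qed.

(** On a compact metrizable space the compact-open topology is the topology of
   uniform convergence: by compactness, finitely many conditions of the form
   [f @` K `<=` V] imply uniform closeness to a given map, and each of them
   leaves room for a uniform error. *)
Lemma tau_kP U : tau_k X U <-> forall g, U g ->
  exists2 e, 0 < e & forall h, (forall x, d (h x) (g x) < e) -> U h.
Proof.
split.
  move=> [V oV ->] g Vg.
  pose F : set_system {compact-open, X -> X} := filter_from [set e | 0 < e]
    (fun e => [set f : X -> X | forall x, d (f x) (g x) < e]).
  have FF : Filter F.
    apply: filter_from_filter; first by exists 1 => /=.
    move=> i j /= i0 j0; exists (Num.min i j); first by rewrite /= lt_min i0.
    move=> f /= fP; split=> x; have := fP x; rewrite lt_min => /andP[] //.
  have Fg : F --> (homeo_fun g : {compact-open, X -> X}).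
    apply/compact_open_cvgP => K O cK oO gKO.
    have [||r r0 rP] := compact_radius md
      (P := fun r x => forall y, d y (g x) < r -> O y) cK.
    - by move=> r s x _ rs sP y yx; apply: sP; lra.
    - move=> x Kx.
      have /(nbhs_metric md) [e e0 eP] : nbhs (g x) O.
        by apply: open_nbhs_nbhs; split => //; apply: gKO; exists x.
      have e20 : 0 < e / 2 by lra.
      have [r r0 rP] := continuous_metric md x (@homeo_fun_cont _ g) e20.
      exists (Num.min r (e / 2)); first by rewrite lt_min r0.
      move=> y; rewrite lt_min => /andP[xyr _] _ z; rewrite lt_min => /andP[_ zy].
      apply: eP; have := rP _ xyr; have := metric_tri md (g y) (g x) z.
      by rewrite (metric_sym md z) in zy; lra.
    by exists r => // f /= fP _ [x Kx <-]; exact: (rP x).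
  have /Fg [e e0 eP] : nbhs (homeo_fun g : {compact-open, X -> X}) V.
    exact: open_nbhs_nbhs.
  by exists e => // h hP; exact: (eP h).
move=> loc.
pose A : set {compact-open, X -> X} :=
  [set f | forall h, homeo_fun h = f -> U h].
exists A^°; first exact: open_interior.
apply/seteqP; split=> [g Ug|g /interior_subset]; last exact.
have [e e0 eP] := loc g Ug.
pose P (f : {compact-open, X -> X}) x := d (f x) (g x) < e.
have : \forall f \near (homeo_fun g : {compact-open, X -> X}), [set: X] `<=` P f.
  have FF : Filter (nbhs (homeo_fun g : {compact-open, X -> X})) by exact: nbhs_filter.
  have := (compact_near_coveringP [set: X]).1 cX _ _ P FF. apply => x _.
  have e30 : 0 < e / 3 by lra.
  have [r r0 rP] := continuous_metric md x (@homeo_fun_cont _ g) e30.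
  pose K := [set y | d (g x) (g y) <= e / 3].
  have cK : compact K.
    apply: (closed_compactX cX).
    rewrite (_ : K = g @^-1` [set y | d (g x) y <= e / 3]) //.
    apply: preimage_closed; first by move=> y _; exact: homeo_fun_cont.
    exact: closed_le_dist.
  pose O := [set y | exists2 z, [set g x] z & d y z < e / 2].
  have oO : open O by exact: (open_near_set md).
  have gKO : nbhs (homeo_fun g : {compact-open, X -> X})
      [set f : {compact-open, X -> X} | f @` K `<=` O].
    apply: open_nbhs_nbhs; split; first exact: compact_open_open.
    move=> _ /= [y Ky <-]; exists (g x) => //.
    by rewrite (metric_sym md); move: Ky; rewrite /K /=; lra.
  exists ([set y | d x y < r], [set f : {compact-open, X -> X} | f @` K `<=` O]).
    by split; [exact: nbhs_metric_ball|exact: gKO].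
  move=> [y f] /= [xy fK].
  have gxy : d (g x) (g y) < e / 3 by exact: rP.
  have [|_ -> fy] := fK (f y); first by exists y => //; rewrite /K /=; lra.
  by rewrite /P; have := metric_tri md (g x) (f y) (g y); lra.
apply: filterS => f fP h hf; apply: eP => x; rewrite hf; exact: (fP x).
Qed.

Lemma tau_k_topology : is_topology (tau_k X).
Proof.
split.
- by apply/tau_kP => g _; exists 1.
- move=> A B /tau_kP tA /tau_kP tB; apply/tau_kP => g [/tA [e e0 eA] /tB [r r0 rB]].
  exists (Num.min e r); first by rewrite lt_min e0.
  by move=> h hP; split; [apply: eA|apply: rB] => x; have := hP x;
    rewrite lt_min => /andP[].
- move=> F tF; apply/tau_kP => g [A FA Ag].
  have /tau_kP /(_ g Ag) [e e0 eP] := tF _ FA.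
  by exists e => // h /eP; exists A.
Qed.

Lemma tau_k_group : group_topology (tau_k X).
Proof.
split; first exact: tau_k_topology.
- move=> x y W /tau_kP tW /tW [e e0 eW].
  have e20 : 0 < e / 2 by lra.
  have [r r0 rP] := uniformly_continuous md cX (@homeo_fun_cont _ x) e20.
  pose B (z : homeo X) (s : R) := [set h : homeo X | exists2 t, t < s & forall w, d (h w) (z w) <= t].
  have oB z s : tau_k X (B z s).
    apply/tau_kP => g [t ts gz]; exists ((s - t) / 2); first lra.
    move=> h hg; exists ((s + t) / 2); first lra.
    move=> w; have := gz w; have := hg w.
    by have := metric_tri md (g w) (h w) (z w); lra.
  have Bz z s : 0 < s -> B z s z.
    by move=> s0; exists 0 => // w; rewrite (metric_refl md).
  exists (B x (e / 2)), (B y r); split; [exact: oB|exact: oB|exact: Bz|exact: Bz|].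
  move=> u v [t te ux] [s sr vy]; apply: eW => w; rewrite !homeoME.
  have vyw : d (v w) (y w) < r by have := vy w; lra.
  have := rP _ _ vyw; have := ux (v w).
  by have := metric_tri md (x (v w)) (u (v w)) (x (y w)); lra.
- move=> W /tau_kP tW; apply/tau_kP => x /tW [e e0 eW].
  have [r r0 rP] := uniformly_continuous md cX (@homeo_fun_cont _ (x^-1)%g) e0.
  exists r => // h hx; apply: eW => w.
  have := rP _ _ (hx ((h^-1)%g w)).
  by rewrite homeoVK homeoKV (metric_sym md).
Qed.

Lemma tau_k_hausdorff : hausdorff_topology (tau_k X).
Proof.
move=> f g fg.
have [x fgx] : exists x, f x <> g x.
  by apply/existsNP => e; apply: fg; apply: homeo_ext.
pose B (z : homeo X) := [set h : homeo X | d (h x) (z x) < d (f x) (g x) / 2].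
have fg0 := metric_gt0 md fgx.
have oB z : tau_k X (B z).
  apply/tau_kP => h; rewrite /B /= => hz.
  exists (d (f x) (g x) / 2 - d (h x) (z x)); first lra.
  by move=> k /(_ x); have := metric_tri md (h x) (k x) (z x); lra.
have Bz z : B z z by rewrite /B /= (metric_refl md) divr_gt0.
exists (B f), (B g); split; [exact: oB|exact: oB|exact: Bz|exact: Bz|].
apply/seteqP; split=> // h; rewrite /B /= => -[hf hg].
by have := metric_tri md (h x) (f x) (g x); rewrite (metric_sym md (f x) (h x)); lra.
Qed.

End CompactOpen.

(** * Homeomorphisms between subsets *)

Lemma homeomorphic_trans (X Y Z : topologicalType) :
  homeomorphic X Y -> homeomorphic Y Z -> homeomorphic X Z.
Proof.
move=> [f [g [cf cg fK gK]]] [f' [g' [cf' cg' fK' gK']]].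
exists (f' \o f), (g \o g'); split.
- by move=> x; exact: continuous_comp (cf x) (cf' _).
- by move=> x; exact: continuous_comp (cg' x) (cg _).
- exact: can_comp.
- exact: can_comp.
Qed.

Definition in_set_type {X : Type} {A : set X} {x : X} (Ax : A x) : A :=
  SigSub (mem_set Ax).

Lemma continuous_set_type (T X : topologicalType) (A : set X) (f : T -> A) :
  continuous (set_val \o f) -> continuous f.
Proof. by move=> cf; apply/continuous_comp_initial. Qed.

Lemma continuous_set_val (X : topologicalType) (A : set X) :
  continuous (set_val : A -> X).
Proof. exact: initial_continuous. Qed.

Lemma continuous_homeo_set_val (X : topologicalType) (h : homeo X) (A : set X) :
  continuous (h \o (set_val : A -> X)).
Proof.
move=> x; apply: continuous_comp; first exact: continuous_set_val.
exact: homeo_fun_cont.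
Qed.

Lemma homeomorphic_image (X : topologicalType) (h : homeo X) (N : set X) :
  homeomorphic (h @` N) N.
Proof.
have fP (y : h @` N) : N ((h^-1)%g (set_val y)).
  by rewrite set_valE; have [x Nx <-] := set_valP y; rewrite homeoVK.
have gP (x : N) : (h @` N) (h (set_val x)).
  by exists (set_val x) => //; exact: set_valP.
exists (fun y => in_set_type (fP y)), (fun x => in_set_type (gP x)); split.
- apply: continuous_set_type.
  exact: (@continuous_homeo_set_val _ (h^-1)%g (h @` N)).
- apply: continuous_set_type; exact: (@continuous_homeo_set_val _ h N).
- by move=> y; apply: val_inj; exact: homeoKV.
- by move=> y; apply: val_inj; exact: homeoVK.
Qed.

Section Points.
Context {R : realType} {X : topologicalType}.
Implicit Types h : homeo X.

Lemma homeo_image_preimage h (A : set X) : h @` A = (h^-1)%g @^-1` A.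
Proof.
apply/seteqP; split=> [_ [x Ax <-]|x Ax].
  by rewrite /preimage /mkset homeoVK.
by exists ((h^-1)%g x) => //; exact: homeoKV.
Qed.

Lemma homeo_nbhs h x (N : set X) : nbhs (h x) N -> nbhs x (h @^-1` N).
Proof. exact: (@homeo_fun_cont _ h x N). Qed.

Lemma homeo_open_image h (A : set X) : open A -> open (h @` A).
Proof.
move=> oA; rewrite homeo_image_preimage.
by apply: open_comp => // x _; exact: homeo_fun_cont.
Qed.

Lemma homeo_closed_image h (A : set X) : closed A -> closed (h @` A).
Proof.
move=> oA; rewrite homeo_image_preimage.
by apply: preimage_closed => // x _; exact: homeo_fun_cont.
Qed.

Lemma arc_points_homeo h x : arc_points R X x -> arc_points R X (h x).
Proof.
move=> [N Nx NI]; exists (h @` N).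
  rewrite homeo_image_preimage; apply: homeo_nbhs.
  by rewrite homeoVK.
by apply: homeomorphic_trans NI; exact: homeomorphic_image.
Qed.

Lemma circle_points_homeo h x : circle_points R X x -> circle_points R X (h x).
Proof.
move=> [N [[oN cN] Nx NI]]; exists (h @` N); split; last 2 first.
- by exists x.
- by apply: homeomorphic_trans NI; exact: homeomorphic_image.
- by split; [exact: homeo_open_image|exact: homeo_closed_image].
Qed.

Lemma arc_points_homeoE h x : arc_points R X (h x) <-> arc_points R X x.
Proof.
split; last exact: arc_points_homeo.
by move=> /(arc_points_homeo (h^-1)%g); rewrite homeoVK.
Qed.

Lemma circle_points_homeoE h x : circle_points R X (h x) <-> circle_points R X x.
Proof.
split; last exact: circle_points_homeo.
by move=> /(circle_points_homeo (h^-1)%g); rewrite homeoVK.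
Qed.

Lemma closure_circle_points_homeo h x :
  closure (circle_points R X) x -> closure (circle_points R X) (h x).
Proof.
move=> clx B /homeo_nbhs /clx [y [Sy By]].
by exists (h y); split => //; exact: circle_points_homeo.
Qed.

Lemma open_arc_points : open (arc_points R X).
Proof.
rewrite openE => x [N Nx NI].
by move: Nx; rewrite /interior nbhsE => -[U [oU Ux UN]]; exists U => // y Uy;
  exists N => //; apply: filterS UN _; exact: open_nbhs_nbhs.
Qed.

Lemma open_circle_points : open (circle_points R X).
Proof.
rewrite openE => x [N [cN Nx NI]]; apply: (@filterS _ _ _ N).
  by move=> y Ny; exists N.
by apply: open_nbhs_nbhs; split => //; case: cN.
Qed.

End Points.

(** A closed set of values of [e] pulls back to a compact part of [K], whose
   image under [p] is closed: this is the continuity of the induced map. *)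
Lemma quotient_map (T Y Z : topologicalType) (K : set T) (p : T -> Y) (e : T -> Z) :
    compact K -> hausdorff_space Y -> continuous p -> continuous e ->
    (forall s t, K s -> K t -> p s = p t -> e s = e t) ->
  exists2 f : p @` K -> e @` K, continuous f &
    forall s y, K s -> set_val y = p s -> set_val (f y) = e s.
Proof.
move=> cK hY cp ce pe.
have lift (y : p @` K) : exists s, K s /\ p s = set_val y.
  by have [s Ks sy] := set_valP y; exists s.
pose l y := sval (cid (lift y)).
have lP y : K (l y) /\ p (l y) = set_val y := svalP (cid (lift y)).
have eP y : (e @` K) (e (l y)) by exists (l y) => //; case: (lP y).
exists (fun y => in_set_type (eP y)) => [|s y Ks yps /=]; last first.
  by have [Kly ply] := lP y; apply: pe => //; rewrite ply.
apply: continuous_set_type; apply/continuous_closedP => A cA.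
have -> : (set_val \o (fun y => in_set_type (eP y))) @^-1` A =
    set_val @^-1` (p @` (K `&` e @^-1` A)).
  apply/seteqP; split=> y; have [Kly ply] := lP y.
    by move=> Aely; exists (l y).
  by move=> [s [Ks Aes] psy]; change (A (e (l y))); rewrite (pe _ s) // ply.
apply: preimage_closed => [y _|]; first exact: continuous_set_val.
apply: compact_closed => //; apply: continuous_compact.
  exact: continuous_subspaceT.
apply: compact_closedI => //; apply: preimage_closed => // t _; exact: ce.
Qed.

Lemma homeomorphic_quotient (T Y Z : topologicalType) (K : set T) (p : T -> Y) (e : T -> Z) :
    compact K -> hausdorff_space Y -> hausdorff_space Z ->
    continuous p -> continuous e ->
    (forall s t, K s -> K t -> p s = p t <-> e s = e t) ->
  homeomorphic (p @` K) (e @` K).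
Proof.
move=> cK hY hZ cp ce pe.
have [f cf fP] := quotient_map cK hY cp ce (fun s t Ks Kt => (pe s t Ks Kt).1).
have [g cg gP] := quotient_map cK hZ ce cp (fun s t Ks Kt => (pe s t Ks Kt).2).
exists f, g; split => // y; apply: val_inj; have [s Ks sy] := set_valP y.
  by rewrite -[LHS]/(set_val _) (gP s _ Ks) //; exact: fP.
by rewrite -[LHS]/(set_val _) (fP s _ Ks) //; exact: gP.
Qed.

(** * Charts of one-dimensional manifolds *)

Section Paths.
Context {R : realType} {X : topologicalType}.
Hypothesis hX : hausdorff_space X.
Implicit Types (p q : R -> X) (a b s t u v : R).

Lemma open_oo a b : open [set t : R | a < t < b].
Proof. by rewrite -set_itvoo; exact: interval_open. Qed.

Lemma compact_cc a b : compact [set t : R | a <= t <= b].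
Proof. by rewrite -set_itvcc; exact: segment_compact. Qed.

Lemma connected_cc a b : connected [set t : R | a <= t <= b].
Proof. by rewrite -set_itvcc; exact: segment_connected. Qed.

Lemma closed_path p a b : continuous p -> closed (p @` [set t | a <= t <= b]).
Proof.
move=> cp; apply: compact_closed => //; apply: continuous_compact.
  exact: continuous_subspaceT.
exact: compact_cc.
Qed.

Lemma connected_path p a b :
  continuous p -> connected (p @` [set t | a <= t <= b]).
Proof.
move=> cp; apply: connected_continuous_connected; first exact: connected_cc.
exact: continuous_subspaceT.
Qed.

(** A chart is defined on all of [R], so that its continuity carries no side
   condition, and is injective on a closed interval, so that the arcs it
   parametrizes are compact. *)
Definition chart p :=
  [/\ continuous p,
      forall s t, -2 <= s <= 2 -> -2 <= t <= 2 -> p s = p t -> s = t &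
      open (p @` [set t | -2 < t < 2])].

Lemma chart_open p a b : chart p -> -2 <= a -> b <= 2 ->
  open (p @` [set t | a < t < b]).
Proof.
move=> [cp ip op] a2 b2.
have -> : p @` [set t | a < t < b] = p @` [set t | -2 < t < 2]
    `&` ~` (p @` [set t | -2 <= t <= a] `|` p @` [set t | b <= t <= 2]).
  apply/seteqP; split=> [_ [t /= /andP[ta tb] <-]|_ [[t /= /andP[t1 t2] <-]]].
    split; first by exists t => //=; apply/andP; split; lra.
    by move=> [] [s /= s12] st; (have {}st : s = t by apply: ip => //; lra); lra.
  move=> /not_orP [n1 n2]; exists t => //=; apply/andP; split.
    by rewrite ltNge; apply/negP => ta; apply: n1; exists t => //=; lra.
  by rewrite ltNge; apply/negP => ta; apply: n2; exists t => //=; lra.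
apply: openI => //; apply: closed_openC; apply: closedU; exact: closed_path.
Qed.

(** The part of [A] in the chart over ]a, b[ is open in [A], and closed in [A]
   because it equals the part over [a, b]. *)
Lemma chart_separates p a b s (A : set X) : chart p -> -2 <= a -> b <= 2 ->
  connected A -> ~ A (p a) -> ~ A (p b) -> a < s < b -> A (p s) ->
  A `<=` p @` [set t | a < t < b].
Proof.
move=> ch a2 b2 cA nAa nAb sab As.
have [cp _ _] := ch.
suff <- : A `&` p @` [set t | a < t < b] = A by move=> x [].
apply: cA; first by exists (p s); split => //; exists s.
  by exists (p @` [set t | a < t < b]) => //; exact: chart_open.
exists (p @` [set t | a <= t <= b]); first exact: closed_path.
apply/seteqP; split=> [x [Ax [t /= /andP[ta tb] tx]]|x [Ax [t /= /andP[ta tb] tx]]].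
  by split=> //; exists t => //=; rewrite !ltW.
split=> //; exists t => //=; rewrite !lt_neqAle ta tb !andbT.
by apply/andP; split; apply/eqP => e; move: Ax; rewrite -tx -?e // e.
Qed.

Lemma affine_continuous (c e : R) : continuous (fun t : R => c + e * t).
Proof.
move=> t; apply: (@continuousD R R^o R^o (cst c) ( *%R e)); first exact: cst_continuous.
by apply: (@mulrl_continuous R e).
Qed.

Lemma clamp_continuous a b : continuous (fun t => Num.max a (Num.min t b) : R).
Proof.
apply: (@max_fun_continuous _ R R (cst a)); first exact: cst_continuous.
apply: (@min_fun_continuous _ R R id (cst b)) => t; [exact: cvg_id|exact: cst_continuous].
Qed.

Lemma clamp_id a b t : a <= t <= b -> Num.max a (Num.min t b) = t.
Proof. by move=> /andP[ta tb]; rewrite (min_l tb) (max_r ta). Qed.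

Lemma clamp_itv a b t : a <= b -> a <= Num.max a (Num.min t b) <= b.
Proof. by move=> ab; rewrite le_max lexx /= ge_max ab ge_min lexx orbT. Qed.

(** The homeomorphism with ]0, 1[ is restricted to a small closed interval around
   the parameter of [x] and extended by constants, so that the whole of [R] is
   mapped into [G]. *)
Lemma exists_chart x G : arc_points R X x -> nbhs x G ->
  exists p, [/\ chart p, p 0 = x & forall t, G (p t)].
Proof.
move=> [N Nx [f [g [cf cg fK gK]]]] Gx.
have [W [oW Wx WNG]] : exists W, [/\ open W, W x & W `<=` N `&` G].
  have : nbhs x (N `&` G) by exact: filterI.
  by rewrite nbhsE => -[W [oW Wx] WNG]; exists W.
have Nxx : N x by case: (WNG _ Wx).
pose n0 := in_set_type Nxx.
pose s0 : R := set_val (f n0).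
have /andP[s01 s02] : 0 < s0 < 1 by exact: (set_valP (f n0)).
pose proj t := Num.max (s0 / 2) (Num.min t ((1 + s0) / 2)).
have projP t : [set t : R | 0 < t < 1] (proj t).
  have /andP[] : s0 / 2 <= proj t <= (1 + s0) / 2 by apply: clamp_itv; lra.
  by rewrite /=; lra.
pose c t : X := set_val (g (in_set_type (projP t))).
have cc : continuous c.
  have cpr : continuous (fun t => in_set_type (projP t)).
    by apply: continuous_set_type; exact: clamp_continuous.
  have cgv : continuous (set_val \o g).
    by move=> n; exact: continuous_comp (cg n) (@continuous_set_val _ _ _).
  by move=> t; exact: continuous_comp (cpr t) (cgv _).
have cE t (It : [set t : R | 0 < t < 1] t) : s0 / 2 <= t <= (1 + s0) / 2 ->
    c t = set_val (g (in_set_type It)).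
  move=> tI; rewrite /c; congr (set_val (g _)); apply: val_inj => /=.
  exact: clamp_id.
have cs0 : c s0 = x.
  have Is0 : [set t : R | 0 < t < 1] s0 by rewrite /= s01 s02.
  rewrite (cE _ Is0); last lra.
  rewrite (_ : in_set_type Is0 = f n0) ?fK //; exact: val_inj.
have [r r0 rW] : exists2 r, 0 < r & forall t, `|t - s0| < r -> W (c t).
  have : nbhs s0 (c @^-1` W).
    by apply: cc; apply: open_nbhs_nbhs; rewrite cs0.
  move=> /nbhs_ballP [r /= r0 rW]; exists r => // t tr; apply: rW.
  by rewrite /ball /= distrC.
pose e := Num.min (r / 3) (Num.min (s0 / 4) ((1 - s0) / 4)).
have e0 : 0 < e by rewrite !lt_min; apply/and3P; split; lra.
have [e1 e2 e3] : [/\ e <= r / 3, e <= s0 / 4 & e <= (1 - s0) / 4].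
  by split; rewrite /e !ge_min lexx ?orbT.
pose p t := c (s0 + e * Num.max (- 2) (Num.min t 2)).
have cp : continuous p.
  move=> t; apply: (@continuous_comp _ _ _ (fun t => s0 + e * Num.max (- 2) (Num.min t 2)) c); last exact: cc.
  apply: (@continuous_comp _ _ _ (fun t => Num.max (- 2) (Num.min t 2)) (fun t => s0 + e * t)).
    exact: clamp_continuous.
  exact: affine_continuous.
have pW t : W (p t).
  apply: rW.
  have /andP[] : - 2 <= Num.max (- 2) (Num.min t 2) <= 2.
    by apply: clamp_itv; lra.
  move: (Num.max _ _) => u u1 u2.
  rewrite addrAC subrr add0r normrM gtr0_norm //.
  have : `|u| <= 2 by rewrite ler_norml u1 u2.
  move: (`|u|) => v v2; nra.
have pE t : -2 <= t <= 2 -> p t = c (s0 + e * t).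
  by move=> t2; rewrite /p clamp_id.
have inI t : -2 <= t <= 2 -> s0 / 2 <= s0 + e * t <= (1 + s0) / 2.
  by move=> /andP[t1 t2]; nra.
have inO t : -2 <= t <= 2 -> [set t : R | 0 < t < 1] (s0 + e * t).
  by move=> /inI /andP[t1 t2] /=; lra.
exists p; split; last by move=> t; case: (WNG _ (pW t)).
  split => //.
    move=> s t s2 t2; rewrite !pE //.
    rewrite (cE _ (inO _ s2) (inI _ s2)) (cE _ (inO _ t2) (inI _ t2)).
    move=> /val_inj /(can_inj gK) /(congr1 val) /= /addrI.
    by apply: mulfI; rewrite gt_eqF.
  pose J := [set t : R | s0 - 2 * e < t < s0 + 2 * e].
  have : open ((set_val \o f) @^-1` J).
    apply: open_comp; last exact: open_oo.
    by move=> n _; exact: continuous_comp (cf n) (@continuous_set_val _ _ _).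
  move=> [B oB BJ].
  rewrite (_ : p @` _ = B `&` W); first exact: openI.
  apply/seteqP; split.
    move=> _ [t /= /andP[t1 t2] <-]; split => //.
    have t22 : -2 <= t <= 2 by rewrite !ltW.
    rewrite pE // (cE _ (inO _ t22) (inI _ t22)).
    rewrite -[B _]/((set_val @^-1` B) (g (in_set_type (inO _ t22)))) BJ.
    rewrite /preimage /mkset /= gK; change (J (s0 + e * t)).
    by rewrite /J /=; apply/andP; split; nra.
  move=> y [By Wy].
  have Ny : N y by case: (WNG _ Wy).
  have : (set_val @^-1` B) (in_set_type Ny) by [].
  rewrite BJ /J /= => /andP[].
  pose s := (set_val (f (in_set_type Ny)) : R).
  rewrite -/s => j1 j2.
  have es : s0 + e * ((s - s0) / e) = s.
    by rewrite mulrC divfK ?gt_eqF // addrC subrK.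
  have sI : -2 < (s - s0) / e < 2.
    rewrite ltr_pdivlMr // ltr_pdivrMr //; lra.
  exists ((s - s0) / e) => //=.
  have sI' : -2 <= (s - s0) / e <= 2 by move: sI => /andP[? ?]; rewrite !ltW.
  rewrite pE // (cE _ (inO _ sI') (inI _ sI')).
  rewrite (_ : in_set_type _ = f (in_set_type Ny)) ?fK //.
  by apply: val_inj => /=; rewrite es.
by rewrite pE ?mulr0 ?addr0 //; lra.
Qed.

End Paths.

(** * Non-commuting homeomorphisms and group topologies *)

Section Bump.
Context {R : realType} {X : topologicalType}.
Hypothesis hX : hausdorff_space X.
Implicit Types (p : R -> X) (a b s t : R).

(** The complement of the arc over ]a, b[ is closed, so a map that is continuous
   there and on the compact arc over [a, b] is continuous. *)
Lemma chart_extension p a b (beta : R -> R) : chart p -> -2 <= a -> b <= 2 ->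
    continuous beta -> beta a = a -> beta b = b ->
    (forall t, a <= t <= b -> a <= beta t <= b) ->
  exists k : X -> X, [/\ continuous k,
    forall t, a <= t <= b -> k (p t) = p (beta t) &
    forall x, ~ (p @` [set t | a < t < b]) x -> k x = x].
Proof.
move=> ch a2 b2 cb ba bb bI; have [cp ip _] := ch.
pose k x := if pselect (exists t, a <= t <= b /\ p t = x) is left H
  then p (beta (sval (cid H))) else x.
have kp t : a <= t <= b -> k (p t) = p (beta t).
  move=> tI; rewrite /k; case: pselect => [H|]; last by case; exists t.
  by case: cid => /= s [sI st]; rewrite (ip s t _ _ st) //; lra.
have kid x : ~ (p @` [set t | a < t < b]) x -> k x = x.
  move=> nx; rewrite /k; case: pselect => // H.
  case: cid => /= t [tI tx]; rewrite -tx; congr p.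
  have [->//|ta] := eqVneq t a; have [->//|tb] := eqVneq t b.
  case: nx; exists t => //=; rewrite !lt_neqAle tb eq_sym ta /=; lra.
exists k; split => //; apply/continuous_closedP => F cF.
have -> : k @^-1` F = (F `&` ~` (p @` [set t | a < t < b])) `|`
    p @` ([set t | a <= t <= b] `&` (p \o beta) @^-1` F).
  apply/seteqP; split=> x /=.
    have [[t /= tI <-]|nx] := pselect ((p @` [set t | a < t < b]) x).
      have tI' : a <= t <= b by lra.
      by rewrite kp // => Fp; right; exists t.
    by rewrite kid //; left.
  move=> [[Fx /kid ->//]|[t [tI Ft] <-]]; by rewrite kp.
apply: closedU.
  by apply: closedI => //; apply: open_closedC; exact: chart_open.
apply: compact_closed => //; apply: continuous_compact.
  exact: continuous_subspaceT.
apply: compact_closedI; first exact: compact_cc.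
apply: preimage_closed => // t _; exact: continuous_comp (cb t) (cp _).
Qed.

(** The squaring map of [0, 1] transported to [a, b]; its inverse is the
   square root. *)
Lemma exists_bump p a b : chart p -> -2 <= a -> b <= 2 -> a < b ->
  exists h : homeo X, (forall x, ~ (p @` [set t | a < t < b]) x -> h x = x) /\
    forall t, a < t < b -> exists2 s, a < s < t & h (p t) = p s.
Proof.
move=> ch a2 b2 ab.
have ab0 : b - a != 0 by rewrite gt_eqF; lra.
pose beta t := a + (t - a) ^+ 2 / (b - a).
pose alpha t := a + Num.sqrt ((t - a) * (b - a)).
have bI t : a <= t <= b -> a <= beta t <= b.
  move=> tI; rewrite /beta; apply/andP; split.
    by rewrite lerDl divr_ge0 ?sqr_ge0 //; lra.
  by rewrite -lerBrDl ler_pdivrMr; nra.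
have aI t : a <= t <= b -> a <= alpha t <= b.
  move=> tI; rewrite /alpha lerDl sqrtr_ge0 /= -lerBrDl.
  rewrite -[b - a in leRHS]ger0_norm; last lra.
  by rewrite -sqrtr_sqr ler_wsqrtr //; nra.
have bK t : a <= t <= b -> alpha (beta t) = t.
  move=> tI; rewrite /alpha (_ : beta t - a = (t - a) ^+ 2 / (b - a)); last first.
    by rewrite /beta addrC addKr.
  rewrite divfK // sqrtr_sqr.
  by rewrite ger0_norm ?subrKC //; lra.
have aK t : a <= t <= b -> beta (alpha t) = t.
  move=> tI; rewrite /beta (_ : alpha t - a = Num.sqrt ((t - a) * (b - a))); last first.
    by rewrite /alpha addrC addKr.
  rewrite sqr_sqrtr; last nra.
  by rewrite mulfK // addrC subrK.
have ba : beta a = a by rewrite /beta subrr expr0n /= mul0r addr0.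
have bb : beta b = b by rewrite /beta expr2 mulfK // addrC subrK.
have aa : alpha a = a by rewrite -[in LHS]ba bK // lexx ltW.
have ab' : alpha b = b by rewrite -[in LHS]bb bK // lexx ltW.
have cb : continuous beta.
  move=> t; apply: cvgD; first exact: cvg_cst.
  apply: cvgM; last exact: cvg_cst.
  by apply: (@cvgM _ _ _ _ (fun t => t - a)); apply: cvgB; (exact: cvg_id || exact: cvg_cst).
have ca : continuous alpha.
  move=> t; apply: cvgD; first exact: cvg_cst.
  apply: (@continuous_comp _ _ _ (fun t => (t - a) * (b - a)) Num.sqrt); last exact: sqrt_continuous.
  apply: cvgM; last exact: cvg_cst.
  by apply: cvgB; [exact: cvg_id|exact: cvg_cst].
have [k [ck kp kid]] := chart_extension ch a2 b2 cb ba bb bI.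
have [l [cl lp lid]] := chart_extension ch a2 b2 ca aa ab' aI.
have inv (u v : X -> X) (f g : R -> R) : (forall t, a <= t <= b -> a <= f t <= b) ->
    (forall t, a <= t <= b -> g (f t) = t) ->
    (forall t, a <= t <= b -> u (p t) = p (f t)) ->
    (forall t, a <= t <= b -> v (p t) = p (g t)) ->
    (forall x, ~ (p @` [set t | a < t < b]) x -> u x = x) ->
    (forall x, ~ (p @` [set t | a < t < b]) x -> v x = x) -> cancel u v.
  move=> fI gf up vp ui vi x.
  have [[t /= tI <-]|nx] := pselect ((p @` [set t | a < t < b]) x).
    have tI' : a <= t <= b by lra.
    by rewrite up // vp ?gf //; exact: fI.
  by rewrite ui // vi.
exists (Homeo ck cl (inv _ _ _ _ bI bK kp lp kid lid)
  (inv _ _ _ _ aI aK lp kp lid kid)); split => //= t tI.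
exists (beta t); last by rewrite kp //; lra.
rewrite /beta; apply/andP; split; first by rewrite ltrDl divr_gt0 ?exprn_gt0 //; lra.
by rewrite -ltrBrDl ltr_pdivrMr; nra.
Qed.

(** The first bump takes the middle point [p t] to some [p s] with s < t; the
   second one is supported over [s, b], so it moves [p t] and fixes [p s]. *)
Lemma exists_noncommuting p a b : chart p -> -2 <= a -> b <= 2 -> a < b ->
  exists f g : homeo X, [/\ (f * g <> g * f)%g,
    forall x, ~ (p @` [set t | a <= t <= b]) x -> f x = x &
    forall x, ~ (p @` [set t | a <= t <= b]) x -> g x = x].
Proof.
move=> ch a2 b2 ab; have [_ ip _] := ch.
have [f [fid fp]] := exists_bump ch a2 b2 ab.
have [|s sI fps] := fp ((a + b) / 2); first lra.
have s2 : -2 <= s by lra.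
have sb : s < b by lra.
have [g [gid gp]] := exists_bump ch s2 b2 sb.
exists f, g; split=> [fg|x nx|x nx].
- have [|u uI gpu] := gp ((a + b) / 2); first lra.
  have : (f * g)%g (p ((a + b) / 2)) = (g * f)%g (p ((a + b) / 2)) by rewrite fg.
  rewrite !homeoME fps (gid (p s)) => [|[t /= tI ts]]; last first.
    have : t = s by apply: ip ts; lra.
    lra.
  rewrite -fps => /homeo_inj; rewrite gpu => e.
  have : u = (a + b) / 2 by apply: ip e; lra.
  lra.
- by apply: fid => -[t /= tI tx]; apply: nx; exists t => //=; lra.
- by apply: gid => -[t /= tI tx]; apply: nx; exists t => //=; lra.
Qed.

End Bump.

Section GroupTopology.
Context {G : groupType} {sigma : set (set G)}.
Hypothesis gs : group_topology sigma.
Hypothesis hs : hausdorff_topology sigma.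
Local Open Scope group_scope.

Lemma topology_locally A :
  (forall x, A x -> exists V, [/\ sigma V, V x & V `<=` A]) -> sigma A.
Proof.
move=> loc; have [[_ _ sU] _ _] := gs.
rewrite (_ : A = \bigcup_(V in [set V | sigma V /\ V `<=` A]) V).
  by apply: sU => V [].
apply/seteqP; split=> [x /loc [V [sV Vx VA]]|x [V [_ VA]]]; last exact: VA.
by exists V.
Qed.

Let continuous_for (phi : G -> G) := forall W, sigma W -> sigma (phi @^-1` W).

Lemma continuous_for_cst x : continuous_for (fun=> x).
Proof.
move=> W sW; have [[sT _ _] _ _] := gs.
by apply: topology_locally => y Wx; exists setT; split=> // z _; exact: Wx.
Qed.

Lemma continuous_for_mul phi psi : continuous_for phi -> continuous_for psi ->
  continuous_for (fun x => phi x * psi x).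
Proof.
move=> cphi cpsi W sW; have [[_ sI _] sM _] := gs.
apply: topology_locally => x /(sM _ _ _ sW) [U [V [sU sV Ux Vx UVW]]].
exists (phi @^-1` U `&` psi @^-1` V); split => //.
  by apply: sI; [exact: cphi|exact: cpsi].
by move=> y [Uy Vy]; exact: UVW.
Qed.

Lemma continuous_for_inv : continuous_for (fun x => x^-1).
Proof. by move=> W; have [_ _] := gs; apply. Qed.

Lemma continuous_for_id : continuous_for id.
Proof. by []. Qed.

Lemma topology_setC1 x : sigma (~` [set x]).
Proof.
apply: topology_locally => y /= /hs [A [B [sA sB Ay Bx AB]]].
exists A; split => // z Az zx; rewrite -[False]/(set0 z) -AB; split => //.
by rewrite zx.
Qed.

(** The commutator of [g] with the conjugate of [f] by [h] depends continuously
   on [h], and the identity is a closed point. *)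
Lemma open_noncommuting (f g : G) :
  sigma [set h | h * f * h^-1 * g <> g * (h * f * h^-1)].
Proof.
pose phi h := h * f * h^-1 * g * (g * (h * f * h^-1))^-1.
rewrite (_ : [set h | _] = phi @^-1` (~` [set 1])).
  have cc : continuous_for (fun h => h * f * h^-1).
    apply: continuous_for_mul continuous_for_inv.
    exact: continuous_for_mul continuous_for_id (@continuous_for_cst f).
  have c1 := continuous_for_mul cc (@continuous_for_cst g).
  have c2 := continuous_for_mul (@continuous_for_cst g) cc.
  apply: (continuous_for_mul c1) (@topology_setC1 1) => W sW.
  exact: c2 (continuous_for_inv sW).
apply/seteqP; split=> h /= nc e; apply: nc; first exact: divg1_eq.
by rewrite /phi e divgg.
Qed.

Lemma open_translate x W : sigma W -> sigma [set h | W (x * h)].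
Proof.
exact: (continuous_for_mul (@continuous_for_cst x) continuous_for_id).
Qed.

End GroupTopology.

(** * Displacement in a coarser Hausdorff group topology *)

Section Displacement.
Context {R : realType} {X : topologicalType}.
Hypothesis hX : hausdorff_space X.
Implicit Types (p : R -> X) (h : homeo X).

Lemma chart_fill_right p u w b (A : set X) : chart p -> connected A ->
  -2 <= u -> b <= 2 -> w < b -> A (p u) -> A (p w) -> ~ A (p b) ->
  forall r, u <= r <= w -> A (p r).
Proof.
move=> ch cA u2 b2 wb Au Aw nAb r /andP[].
rewrite le_eqVlt => /predU1P[<- //|ur]; rewrite le_eqVlt => /predU1P[-> //|rw].
have [_ ip _] := ch; apply: contrapT => nAr.
have r2 : -2 <= r by lra.
have rwb : r < w < b by lra.
have [t /= tI tu] := chart_separates hX ch r2 b2 cA nAr nAb rwb Aw Au.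
have : t = u by apply: ip tu; lra.
lra.
Qed.

Lemma chart_fill_left p u w a (A : set X) : chart p -> connected A ->
  w <= 2 -> -2 <= a -> a < u -> A (p u) -> A (p w) -> ~ A (p a) ->
  forall r, u <= r <= w -> A (p r).
Proof.
move=> ch cA w2 a2 au Au Aw nAa r /andP[].
rewrite le_eqVlt => /predU1P[<- //|ur]; rewrite le_eqVlt => /predU1P[-> //|rw].
have [_ ip _] := ch; apply: contrapT => nAr.
have r2 : r <= 2 by lra.
have aur : a < u < r by lra.
have [t /= tI tu] := chart_separates hX ch a2 r2 cA nAa nAr aur Au Aw.
have : t = w by apply: ip tu; lra.
lra.
Qed.

(** A third point between the end points prevents the image of the arc from
   running from one end to the other through the rest of the space, as it could
   on a circle. *)
Lemma chart_three_points p h s1 s2 s3 t1 t2 t3 : chart p ->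
    -2 <= s1 -> s1 < s2 -> s2 < s3 -> s3 <= 2 ->
    -2 <= t1 -> t1 < t2 -> t2 < t3 -> t3 <= 2 ->
    h (p s1) = p t1 -> h (p s2) = p t2 -> h (p s3) = p t3 ->
  forall r, s1 <= r <= s3 -> exists t, h (p r) = p t.
Proof.
move=> ch s12 s1s2 s2s3 s32 t12 t1t2 t2t3 t32 h1 h2 h3 r rI.
have [cp ip _] := ch.
pose A u v := (h^-1)%g @` (p @` [set t | u <= t <= v]).
have cA u v : connected (A u v).
  apply: connected_continuous_connected; first exact: connected_path.
  apply: continuous_subspaceT => x; exact: homeo_fun_cont.
have AE u v s t : -2 <= u -> v <= 2 -> -2 <= t <= 2 -> h (p s) = p t ->
    A u v (p s) <-> u <= t <= v.
  move=> u2 v2 tI2 hst; split=> [[_ [w /= wI <-] /(congr1 h)]|tI].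
    by rewrite homeoKV hst => e; rewrite -(ip w t _ _ e) //; lra.
  exists (p t); last by rewrite -hst homeoVK.
  by exists t.
have [rs|rs] := leP r s2.
  have [||||_ [t _ <-] tr] := @chart_fill_right p s1 s2 s3 (A t1 t2) ch (cA _ _) s12 s32 s2s3 _ _ _ r _.
  - by apply/(AE _ _ _ _ _ _ _ h1); lra.
  - by apply/(AE _ _ _ _ _ _ _ h2); lra.
  - by move=> /(AE _ _ _ _ _ _ _ h3); lra.
  - lra.
  by exists t; rewrite -tr homeoKV.
have [||||_ [t _ <-] tr] := @chart_fill_left p s2 s3 s1 (A t2 t3) ch (cA _ _) s32 s12 s1s2 _ _ _ r _.
- by apply/(AE _ _ _ _ _ _ _ h2); lra.
- by apply/(AE _ _ _ _ _ _ _ h3); lra.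
- by move=> /(AE _ _ _ _ _ _ _ h1); lra.
- lra.
by exists t; rewrite -tr homeoKV.
Qed.

Context {sigma : set (set (homeo X))}.
Hypothesis gs : group_topology sigma.
Hypothesis hs : hausdorff_topology sigma.

(** If [h] moved the arc off itself, then the conjugate by [h] of a
   homeomorphism supported in the arc would commute with every homeomorphism
   supported in the arc. *)
Lemma chart_meets_image p a b : chart p -> -2 <= a -> b <= 2 -> a < b ->
  exists W, [/\ sigma W, W 1%g & forall h, W h ->
    exists s t, [/\ a <= s <= b, a <= t <= b & h (p s) = p t]].
Proof.
move=> ch a2 b2 ab.
have [f [g [fg fid gid]]] := exists_noncommuting hX ch a2 b2 ab.
exists [set h | (h * f * h^-1 * g <> g * (h * f * h^-1))%g]; split.
- exact: (open_noncommuting gs hs).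
- by rewrite /= mul1g invg1 mulg1.
move=> h /= hfg; apply: contrapT => disj; apply: hfg.
set c := (h * f * h^-1)%g; pose J := p @` [set t | a <= t <= b].
have hJ x : J x -> ~ J (h x).
  by move=> [s sI <-] [t tI e]; apply: disj; exists s, t.
have keep (k : homeo X) x : (forall x, ~ J x -> k x = x) -> J x -> J (k x).
  move=> kid Jx; apply: contrapT => nJ; apply: (nJ).
  by rewrite (homeo_inj (kid _ nJ)).
have cid1 x : J x -> c x = x.
  move=> Jx; rewrite /c !homeoME fid ?homeoKV // => Jh.
  by apply: (hJ _ Jh); rewrite homeoKV.
have cJ x : ~ J x -> ~ J (c x).
  move=> nJ; have [Jh|nJh] := pselect (J ((h^-1)%g x)).
    by rewrite /c !homeoME; apply: hJ; exact: keep.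
  by rewrite /c !homeoME fid ?homeoKV.
apply: homeo_ext => x; rewrite [LHS]homeoME [RHS]homeoME.
have [Jx|nJ] := pselect (J x); first by rewrite !cid1 //; exact: keep.
by rewrite (gid _ nJ) (gid _ (cJ _ nJ)).
Qed.

End Displacement.

Section Minimality.
Context {R : realType} {X : topologicalType} {d : X -> X -> R}.
Hypothesis md : compatible_metric d.
Hypothesis cX : compact [set: X].
Let C : set X := ~` arc_points R X.
Context {sigma : set (set (homeo X))}.
Hypothesis gs : group_topology sigma.
Hypothesis hs : hausdorff_topology sigma.

(** Three consecutive arcs around [x], each of them meeting its image, pin down
   the image of everything between the outer two. *)
Lemma small_displacement_near x e : arc_points R X x -> 0 < e ->
  exists W U, [/\ sigma W, W 1%g, nbhs x U &
    forall h y, W h -> U y -> d (h y) y < e].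
Proof.
move=> Ox e0; have hX := metric_hausdorff md.
have [[_ sI _] _ _] := gs.
have e20 : 0 < e / 2 by lra.
have [p [ch p0 pG]] := exists_chart Ox (nbhs_metric_ball md x e20).
have [|||W1 [sW1 W11 W1P]] := @chart_meets_image R X hX sigma gs hs p (-2) (-1) ch _ _ _; try lra.
have [|||W2 [sW2 W21 W2P]] := @chart_meets_image R X hX sigma gs hs p (-1 / 2) (1 / 2) ch _ _ _; try lra.
have [|||W3 [sW3 W31 W3P]] := @chart_meets_image R X hX sigma gs hs p 1 2 ch _ _ _; try lra.
exists (W1 `&` W2 `&` W3), (p @` [set t | -1 < t < 1]); split.
- exact: (sI _ _ (sI _ _ sW1 sW2) sW3).
- by [].
- apply: open_nbhs_nbhs; split; first by apply: chart_open => //; lra.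
  by exists 0 => //=; lra.
move=> h y [[/W1P [s1 [t1 [s1I t1I h1]]] /W2P [s2 [t2 [s2I t2I h2]]]]].
move=> /W3P [s3 [t3 [s3I t3I h3]]] [r /= rI <-].
have [||||||||| t ->] := @chart_three_points R X hX p h s1 s2 s3 t1 t2 t3 ch _ _ _ _ _ _ _ _ h1 h2 h3 r _;
  try lra.
have := pG t; have := pG r; have := metric_tri md x (p t) (p r).
by rewrite (metric_sym md (p t) x) /=; lra.
Qed.

(** What lies at distance at least [e] from [C] is a compact set of arc points,
   so finitely many local estimates of the displacement suffice. *)
Lemma B_kC_nbhs1 e : 0 < e -> exists W, [/\ sigma W, W 1%g & W `<=` B_kC d C e].
Proof.
move=> e0; have [[sT sI _] _ sV] := gs.
pose F : set_system (homeo X) := filter_from [set W | sigma W /\ W 1%g] id.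
have FF : Filter F.
  apply: filter_from_filter; first by exists setT.
  by move=> V W [sV' V1] [sW W1]; exists (V `&` W) => //; split=> //; exact: sI.
pose K := ~` metric_nbhd d C e.
have cK : compact K.
  apply: (closed_compactX cX); apply: open_closedC.
  rewrite (_ : metric_nbhd d C e = [set x | exists2 c, C c & d x c < e]).
    exact: open_near_set.
  by apply/seteqP; split=> x /metric_nbhdP.
have KO x : K x -> arc_points R X x.
  move=> Kx; apply: contrapT => Cx; apply: Kx; apply/metric_nbhdP.
  by exists x => //; rewrite (metric_refl md).
pose P (h : homeo X) x := d (h x) x < e.
have := (compact_near_coveringP K).1 cK _ F P FF.
case=> [x /KO Ox|W [sW W1] WP].
  have [W [U [sW W1 Ux WU]]] := small_displacement_near Ox e0.
  exists (U, W) => /=; first by split => //; exists W.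
  by move=> [y h] /= [Uy Wh]; exact: WU.
exists (W `&` [set h | W (h^-1)%g]); split; first by apply: sI => //; exact: sV.
  by split => //=; rewrite invg1.
by move=> h [/WP Ph /= /WP PVh] x nx; split; [exact: Ph|exact: PVh].
Qed.

End Minimality.

Section Comparison.
Context {R : realType} {X : topologicalType} {d : X -> X -> R}.
Hypothesis md : compatible_metric d.
Hypothesis cX : compact [set: X].
Let C : set X := ~` arc_points R X.

Lemma tau_k_B_kC (A : set X) e : tau_k X (B_kC d A e).
Proof.
pose B := [set h : homeo X | forall x, ~ metric_nbhd d A e x -> d (h x) x < e].
have [_ _ tV] := tau_k_group md cX; have [_ tI _] := tau_k_topology md cX.
suff tB : tau_k X B.
  rewrite (_ : B_kC d A e = B `&` [set h | B (h^-1)%g]).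
    by apply: tI => //; exact: tV.
  apply/seteqP; split=> [h hB|h [hB hVB] x nx]; last by split; [exact: hB|exact: hVB].
  by split=> x /hB [].
apply/(tau_kP md cX) => g gB.
pose K := ~` metric_nbhd d A e.
have cK : compact K.
  apply: (closed_compactX cX); apply: open_closedC.
  rewrite (_ : metric_nbhd d A e = [set x | exists2 c, A c & d x c < e]).
    exact: open_near_set.
  by apply/seteqP; split=> x /metric_nbhdP.
have [||r r0 rP] := compact_radius md
  (P := fun r x => forall y, d y (g x) < r -> d y x < e) cK.
- by move=> r s x r0 rs sP y yx; apply: sP; lra.
- move=> x /gB gx.
  have e30 : 0 < (e - d (g x) x) / 3 by lra.
  have [r r0 rP] := continuous_metric md x (@homeo_fun_cont _ g) e30.
  exists (Num.min r ((e - d (g x) x) / 3)); first by rewrite lt_min r0.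
  move=> y; rewrite lt_min => /andP[/rP xy1 xy2] _ z.
  rewrite lt_min => /andP[_ zy].
  have := metric_tri md (g y) z y; have := metric_tri md (g x) (g y) y.
  have := metric_tri md x (g x) y; rewrite (metric_sym md (g y) (g x)); lra.
by exists r => // h hg x nx; exact: rP.
Qed.

Lemma tau_kC_sub_tau_k (A : set X) : tau_kC d A `<=` tau_k X.
Proof.
move=> _ [F FB ->]; have [_ _ tU] := tau_k_topology md cX.
apply: tU => B /FB [g [e [e0 ->]]].
rewrite (_ : [set _ | h in _] = [set h | B_kC d A e (g^-1 * h)%g]).
  exact: (open_translate (tau_k_group md cX) _ (tau_k_B_kC _ _)).
apply/seteqP; split=> [_ [h hB <-]|h hB] /=; first by rewrite mulKg.
by exists (g^-1 * h)%g => //; rewrite mulVKg.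
Qed.

Hypothesis unif : forall e, 0 < e ->
  exists2 r, 0 < r & forall h, B_kC d C r h -> forall x, d (h x) x < e.

Lemma tau_k_translate U g : tau_k X U -> U g ->
  exists2 r, 0 < r & forall h, B_kC d C r h -> U (g * h)%g.
Proof.
move=> /(tau_kP md cX) tU /tU [e e0 eU].
have [s s0 sP] := uniformly_continuous md cX (@homeo_fun_cont _ g) e0.
have [r r0 rP] := unif s0.
by exists r => // h /rP hr; apply: eU => x; rewrite homeoME; exact: sP.
Qed.

Lemma tau_kC_eq : tau_kC d C = tau_k X.
Proof.
apply/seteqP; split; first exact: tau_kC_sub_tau_k.
move=> U tU; exists [set A | A `<=` U /\ exists (g : homeo X) (e : R),
    0 < e /\ A = [set (g * h)%g | h in B_kC d C e]]; first by move=> A [].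
apply/seteqP; split=> [g Ug|g [A [AU _] /AU //]].
have [r r0 rP] := tau_k_translate tU Ug.
exists [set (g * h)%g | h in B_kC d C r].
  by split; [move=> _ [h /rP ? <-]|exists g, r].
exists 1%g; last by rewrite mulg1.
by move=> x _; rewrite invg1 (metric_refl md).
Qed.

Lemma tau_k_minimal : minimal_group_topology (tau_k X).
Proof.
split; [exact: tau_k_group md cX|exact: tau_k_hausdorff md cX|].
move=> sigma [sk tN] gs hs; apply: tN => U tU.
apply: (topology_locally gs) => g Ug.
have [r r0 rP] := tau_k_translate tU Ug.
have [W [sW W1 WB]] := B_kC_nbhs1 md cX gs hs r0.
exists [set h | W (g^-1 * h)%g]; split.
- exact: (open_translate gs _ sW).
- by rewrite /= mulVg.
- by move=> h Wh; move: (rP _ (WB _ Wh)); rewrite mulVKg.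
Qed.

End Comparison.

(** * Continuation of curves *)

Section Continuation.
Context {R : realType} {X : topologicalType}.
Hypothesis hX : hausdorff_space X.
Implicit Types (p g : R -> X) (a b r s t u v : R).

(** Invariance of domain for curves.  In a chart at [g s] the two halves of the
   curve at [g s] leave towards opposite sides, since two connected sets leaving
   towards the same side would overlap; together they fill a neighbourhood. *)
Lemma open_curve g a b : continuous g ->
    (forall s t, a < s < b -> a < t < b -> g s = g t -> s = t) ->
    (forall t, a < t < b -> arc_points R X (g t)) ->
  open (g @` [set t | a < t < b]).
Proof.
move=> cg ig gO; rewrite openE => _ [s /= sI <-]; rewrite /interior.
have [p [ch p0 _]] := exists_chart (gO _ sI) (@filterT _ _ _).
have [cp ip op] := ch.
have : nbhs s (g @^-1` (p @` [set t | -2 < t < 2])).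
  apply: cg; apply: open_nbhs_nbhs; split => //; rewrite -p0.
  by exists 0 => //=; lra.
move=> /nbhs_ballP [e0 /= e00 e0P].
pose e := Num.min (e0 / 2) (Num.min ((s - a) / 2) ((b - s) / 2)).
have e_gt0 : 0 < e by rewrite !lt_min; apply/and3P; split; lra.
have [e1 e2 e3] : [/\ e <= e0 / 2, e <= (s - a) / 2 & e <= (b - s) / 2].
  by split; rewrite /e !ge_min lexx ?orbT.
have gp t : s - e <= t <= s + e -> exists2 r, -2 < r < 2 & p r = g t.
  move=> tI; have [|r rI rt] := e0P t; last by exists r.
  by rewrite /ball /= ltr_norml; lra.
have sub u v : s - e <= u -> v <= s + e ->
    g @` [set t | u <= t <= v] `<=` p @` [set t | -2 < t < 2].
  by move=> us vs _ [t /= tI <-]; have [|r rI rt] := gp t; [lra|exists r].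
have fill u v r r' : s - e <= u -> v <= s + e -> -2 < r -> r' < 2 ->
    (g @` [set t | u <= t <= v]) (p r) -> (g @` [set t | u <= t <= v]) (p r') ->
    forall w, r <= w <= r' -> (g @` [set t | u <= t <= v]) (p w).
  move=> us vs r2 r'2 gr gr' w wI.
  have r2' : -2 <= r by lra.
  have t2 : 2 <= (2 : R) by [].
  apply: (chart_fill_right hX ch (connected_path (a := u) (b := v) cg) r2' t2 r'2 gr gr' _ wI).
  move=> /(sub _ _ us vs) [t /= tI te].
  have : t = 2 by apply: ip te; lra.
  lra.
have [r1 r1I r1E] : exists2 r, -2 < r < 2 & p r = g (s - e) by apply: gp; lra.
have [r2 r2I r2E] : exists2 r, -2 < r < 2 & p r = g (s + e) by apply: gp; lra.
have nr1 : r1 <> 0.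
  by move=> r10; move: r1E; rewrite r10 p0 => /ig => H; have := H _ _; lra.
have nr2 : r2 <> 0.
  by move=> r20; move: r2E; rewrite r20 p0 => /ig => H; have := H _ _; lra.
have key r r' : -2 < r -> r' < 2 -> r < 0 < r' ->
    (g @` [set t | s - e <= t <= s + e]) (p r) ->
    (g @` [set t | s - e <= t <= s + e]) (p r') ->
    nbhs (g s) (g @` [set t | a < t < b]).
  move=> rl r'l r0 gr gr'; apply: (@filterS _ _ _ (p @` [set t | r < t < r'])).
    move=> _ [w /= wI <-].
    have [|||||t tI <-] := fill (s - e) (s + e) r r' _ _ _ _ gr gr' w _; try lra.
    by exists t => //=; move: tI => /=; lra.
  apply: open_nbhs_nbhs; split; last by rewrite -p0; exists 0.
  by apply: chart_open => //; lra.
have in1 : (g @` [set t | s - e <= t <= s]) (p r1).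
  by rewrite r1E; exists (s - e) => //=; lra.
have in2 : (g @` [set t | s <= t <= s + e]) (p r2).
  by rewrite r2E; exists (s + e) => //=; lra.
have in01 : (g @` [set t | s - e <= t <= s]) (p 0).
  by rewrite p0; exists s => //=; lra.
have in02 : (g @` [set t | s <= t <= s + e]) (p 0).
  by rewrite p0; exists s => //=; lra.
have in1' : (g @` [set t | s - e <= t <= s + e]) (p r1).
  by rewrite r1E; exists (s - e) => //=; lra.
have in2' : (g @` [set t | s - e <= t <= s + e]) (p r2).
  by rewrite r2E; exists (s + e) => //=; lra.
have not1 : ~ (g @` [set t | s <= t <= s + e]) (p r1).
  rewrite r1E => -[t /= tI te].
  have : t = s - e by apply: ig te; lra.
  lra.
have not2 : ~ (g @` [set t | s - e <= t <= s]) (p r2).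
  rewrite r2E => -[t /= tI te].
  have : t = s + e by apply: ig te; lra.
  lra.
have [r1n|r1p] := ltP r1 0; have [r2n|r2p] := ltP r2 0.
- have [r12|r12] := leP r1 r2.
    by case: not2; apply: (fill _ _ r1 0); rewrite ?r1n; try lra.
  by case: not1; apply: (fill _ _ r2 0); try lra.
- by apply: (key r1 r2) => //; try lra; have /eqP := nr2; lra.
- by apply: (key r2 r1) => //; try lra; have /eqP := nr1; lra.
- have [r12|r12] := leP r1 r2.
    by case: not1; apply: (fill _ _ 0 r2); try lra.
  by case: not2; apply: (fill _ _ 0 r1); try lra.
Qed.

Lemma glue_continuous (f g : R -> X) s : continuous f -> continuous g ->
  f s = g s -> continuous (fun t => if t <= s then f t else g t).
Proof.
move=> cf cg fg; apply/continuous_closedP => F cF.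
rewrite (_ : _ @^-1` F = ([set t | t <= s] `&` f @^-1` F) `|`
    ([set t | s <= t] `&` g @^-1` F)).
  apply: closedU; apply: closedI; [exact: closed_le| |exact: closed_ge|].
    by apply: preimage_closed => // t _; exact: cf.
  by apply: preimage_closed => // t _; exact: cg.
apply/seteqP; split=> t /=; case: (ltgtP t s) => // ts.
- by left.
- by right.
- by left.
- by case=> -[].
- by case=> -[].
- by case=> -[] // _; rewrite ts fg.
Qed.

Lemma first_hit g a b (K : set X) : continuous g -> closed K -> a <= b -> K (g b) ->
  exists t, [/\ a <= t <= b, K (g t) & forall s, a <= s < t -> ~ K (g s)].
Proof.
move=> cg cK ab Kb.
pose A := [set t | a <= t <= b] `&` g @^-1` K.
have cA : compact A.
  apply: compact_closedI; first exact: compact_cc.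
  by apply: preimage_closed => // t _; exact: cg.
have A0 : A !=set0 by exists b; split => //=; rewrite ab lexx.
have [t /set_mem [tI Kt] tmin] := @compact_EVT_min _ _ id _ A0 cA
  (continuous_subspaceT (fun x => cvg_id)).
exists t; split => // s sI Ks.
have /tmin /= : s \in A by apply/mem_set; split => //=; move: tI => /=; lra.
lra.
Qed.

Definition continue_along g s p r t := if t <= s then g t else p (r + (t - s)).

Lemma continue_along_l g s p r t : t <= s -> continue_along g s p r t = g t.
Proof. by rewrite /continue_along => ->. Qed.

Lemma continue_along_r g s p r t : g s = p r -> 0 <= t ->
  continue_along g s p r (s + t) = p (r + t).
Proof.
move=> gp; rewrite le_eqVlt /continue_along => /predU1P[<-|t0].
  by rewrite !addr0 lexx.
by rewrite gerDl leNgt t0 /= addrAC subrr add0r.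
Qed.

Lemma continue_along_continuous g s p r :
  continuous g -> continuous p -> g s = p r -> continuous (continue_along g s p r).
Proof.
move=> cg cp gp.
apply: (@glue_continuous g (fun t => p (r + (t - s)))) => //; last first.
  by rewrite subrr addr0.
move=> t; apply: (@continuous_comp _ _ _ (fun t => r + (t - s)) p); last exact: cp.
apply: (@continuousD R R^o R^o (cst r) (fun t => t - s)); first exact: cst_continuous.
by apply: cvgB; [exact: cvg_id|exact: cvg_cst].
Qed.

Lemma continue_along_inj g a s p r r' : chart p ->
    (forall t u, a <= t <= s -> a <= u <= s -> g t = g u -> t = u) ->
    -2 <= r -> r' <= 2 -> g s = p r ->
    (forall t u, a <= t < s -> r <= u < r' -> g t <> p u) ->
  forall t u, a <= t < s + (r' - r) -> a <= u < s + (r' - r) ->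
    continue_along g s p r t = continue_along g s p r u -> t = u.
Proof.
move=> [_ ip _] ig r2 r'2 gp disj.
have mixed t u : a <= t <= s -> s < u < s + (r' - r) -> g t <> p (r + (u - s)).
  move=> tI uI; have [ts|ts] := ltP t s; first by apply: disj; lra.
  have -> : t = s by lra.
  rewrite gp => e; have : r = r + (u - s) by apply: ip e; lra.
  lra.
move=> t u tI uI; rewrite /continue_along.
have [ts|ts] := leP t s; have [us|us] := leP u s.
- by apply: ig; lra.
- by move=> /mixed []; lra.
- by move=> /esym /mixed []; lra.
- by move=> e; have : r + (t - s) = r + (u - s) by [apply: ip e; lra]; lra.
Qed.

Lemma chart_opp p : chart p -> chart (fun t => p (- t)).
Proof.
move=> [cp ip op]; split.
- move=> t; apply: (@continuous_comp _ _ _ -%R p); last exact: cp.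
  exact: opp_continuous.
- move=> s t s2 t2 /ip e; apply: oppr_inj; apply: e; lra.
- rewrite (_ : _ @` _ = p @` [set t | -2 < t < 2]) //.
  apply/seteqP; split=> _ [t /= tI <-]; exists (- t); rewrite /= ?opprK //; lra.
Qed.

End Continuation.

(** * Rays in a compact one-dimensional manifold *)

Section Rays.
Context {R : realType} {X : topologicalType}.
Hypothesis hX : hausdorff_space X.
Context {Q : set X} {phi : R -> X}.
Hypothesis cQ : clopen Q.
Hypothesis QO : Q `<=` arc_points R X.
Hypothesis ch : chart phi.
Hypothesis phiQ : forall t, Q (phi t).
Implicit Types (g : R -> X) (r s t u v S T : R).

Let cphi : continuous phi. Proof. by case: ch. Qed.
Let iphi s t : -2 <= s <= 2 -> -2 <= t <= 2 -> phi s = phi t -> s = t.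
Proof. by case: ch => _ + _; apply. Qed.

Definition injective_to T g :=
  forall s t, -1 <= s <= T -> -1 <= t <= T -> g s = g t -> s = t.

(** A ray starts at [phi (-1)], runs along [phi] as far as [phi 0] and goes on
   from there in [Q].  Rays follow the manifold [Q] around, until it comes back
   to [phi (-1)] from behind. *)
Definition ray (x : (R -> X) * R) :=
  [/\ continuous x.1, 0 < x.2, forall t, -1 <= t <= 0 -> x.1 t = phi t,
      injective_to x.2 x.1 & forall t, -1 <= t <= x.2 -> Q (x.1 t)].

Definition trace (x : (R -> X) * R) := x.1 @` [set t | -1 < t < x.2].

Lemma ray_chart : ray (phi, 1).
Proof.
by split => //= s t sI tI; apply: iphi; lra.
Qed.

Lemma open_trace x : ray x -> open (trace x).
Proof.
move=> [cg T0 _ ig gQ]; apply: (open_curve hX cg).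
  by move=> s t sI tI; apply: ig; lra.
by move=> t tI; apply: QO; apply: gQ; lra.
Qed.

Lemma ray_shorten g T S : ray (g, T) -> 0 < S <= T -> ray (g, S).
Proof.
move=> [/= cg T0 gphi ig gQ] /andP[S0 ST]; split => //=.
  by move=> s t sI tI; apply: ig; lra.
by move=> t tI; apply: gQ; lra.
Qed.

(** Rays agree as long as both run: one that does not pass through the end of
   another can only follow it. *)
Lemma ray_follows g T f S : ray (g, T) -> ray (f, S) ->
  (forall s, -1 <= s <= S -> f s <> g T) ->
  f @` [set t | -1 < t <= S] `<=` trace (g, T).
Proof.
move=> rg rf ne; have [/= cg T0 gphi ig gQ] := rg.
have [/= cf S0 fphi jf fQ] := rf.
have sub0 s : -1 < s <= 0 -> trace (g, T) (f s).
  by move=> sI; exists s => /=; [lra|rewrite gphi ?fphi //; lra].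
suff AE : f @` [set t | 0 <= t <= S] `&` trace (g, T) = f @` [set t | 0 <= t <= S].
  move=> _ [s /= sI <-]; have [s0|s0] := leP s 0; first by apply: sub0; lra.
  have : (f @` [set t | 0 <= t <= S]) (f s) by exists s => //=; lra.
  by rewrite -AE => -[].
apply: (connected_path (a := 0) (b := S) cf).
- by exists (f 0); split; [exists 0 => //=; lra|apply: sub0; lra].
- by exists (trace (g, T)) => //; exact: open_trace.
exists (g @` [set t | -1 <= t <= T]); first exact: closed_path.
apply/seteqP; split=> x [[s /= sI <-]] [t /= tI tx]; split; try by exists s.
  by exists t => //=; lra.
exists t => //=; apply/andP; split; rewrite lt_neqAle; apply/andP; split; try lra.
  apply/eqP => t1; have N1 : -1 <= (-1 : R) <= 0 by rewrite lexx lerN10.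
  have e : f (-1) = f s by rewrite -tx -t1 (fphi _ N1) (gphi _ N1).
  by have : -1 = s by [apply: jf e; lra]; lra.
by apply/eqP => tT; apply: (ne s); [lra|rewrite -tT].
Qed.

(** Otherwise each ray would pass through the end of the other one.  With both
   cut there, the second would follow the first, so that the end of the first
   would lie on it a second time. *)
Lemma trace_nested x y : ray x -> ray y -> trace x `<=` trace y \/ trace y `<=` trace x.
Proof.
move: x y => [g T] [f S] rg rf.
have end_in (g1 f1 : R -> X) T1 S1 : ray (g1, T1) -> ray (f1, S1) ->
    ~ trace (f1, S1) `<=` trace (g1, T1) ->
    exists s, 0 < s < S1 /\ f1 s = g1 T1.
  move=> r1 r2 nsub; apply: contrapT => nex; apply: nsub => _ [s0 /= s0I <-].
  apply: contrapT => ns0.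
  have [/= cg T0 gphi ig gQ] := r1; have [/= cf S0 fphi jf fQ] := r2.
  have s00 : 0 < s0.
    rewrite ltNge; apply/negP => s00; apply: ns0; exists s0 => /=; first lra.
    by rewrite gphi ?fphi //; lra.
  apply: ns0; apply: (ray_follows r1 (ray_shorten (S := s0) r2 _)); last 2 first.
  - move=> s sI e; apply: nex; exists s; split => //.
    have [s_le0|s_gt0] := leP s 0; last lra.
    have sI0 : -1 <= s <= 0 by lra.
    have e' : g1 T1 = g1 s by rewrite -e (fphi _ sI0) (gphi _ sI0).
    by have : T1 = s by [apply: ig e'; lra]; lra.
  - by exists s0 => //=; lra.
  - lra.
apply: contrapT => /not_orP [n1 n2].
have [s [sI fs]] := end_in _ _ _ _ rg rf n2.
have [t [tI gt]] := end_in _ _ _ _ rf rg n1.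
have [/= _ _ _ ig _] := rg; have [/= _ _ _ jf _] := rf.
have rg' : ray (g, t) by apply: (ray_shorten rg); lra.
have rf' : ray (f, s) by apply: (ray_shorten rf); lra.
have [||u /= uI gu] := ray_follows rg' rf' _ (_ : (f @` [set t | -1 < t <= s]) (f s)).
- by move=> v vI; rewrite gt => /jf vS; have := vS _ _; lra.
- by exists s => //=; lra.
by move: gu; rewrite fs => /ig uT; have := uT _ _; lra.
Qed.

Definition reach := \bigcup_(x in ray) trace x.

(** In a chart at a limit point [z] of rays, some ray enters, and from its first
   entry it can be continued along the chart across [z].  Only the starting
   point escapes, since a ray continued through it would not be injective. *)
Lemma reach_closed z : closure reach z -> z <> phi (-1) -> reach z.
Proof.
move=> clz zv; apply: contrapT => nz.
have Qz : Q z.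
  apply: (cQ.2) => B /clz [y [[x [_ _ _ _ gQ] [t /= tI ty]] By]]; exists y.
  by split => //; rewrite -ty; apply: gQ; lra.
have nphi : ~ (phi @` [set t | -1 <= t <= 0]) z.
  move=> [t /= tI tz]; apply: nz; exists (phi, 1); first exact: ray_chart.
  exists t => //=; apply/andP; split; last lra.
  by rewrite lt_neqAle; apply/andP; split; [apply/eqP => t1; apply: zv; rewrite t1 tz|lra].
have Gz : nbhs z (Q `&` ~` (phi @` [set t | -1 <= t <= 0])).
  apply: open_nbhs_nbhs; split; last by [].
  by apply: openI; [case: cQ|apply: closed_openC; exact: closed_path].
have [p [chp p0 pG]] := exists_chart (QO Qz) Gz.
have [r [s [[g T] [rg [sI gs rI]]]]] : exists r s (x : (R -> X) * R),
    ray x /\ [/\ -1 < s < x.2, x.1 s = p r & -1 < r < 1].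
  have : nbhs z (p @` [set t | -1 < t < 1]).
    apply: open_nbhs_nbhs; split; first by apply: chart_open => //; lra.
    by exists 0 => //=; lra.
  by move=> /clz [_ [[x rx [s /= sI <-]] [r /= rI rs]]]; exists r, s, x.
move: sI gs => /= sI gs; have [/= cg T0 gphi ig gQ] := rg.
have s0 : 0 < s.
  rewrite ltNge; apply/negP => s0; have [_ []] := pG r.
  by rewrite -gs gphi /=; [exists s => //=; lra|lra].
have cp : continuous p by case: chp.
have ip u v : -2 <= u <= 2 -> -2 <= v <= 2 -> p u = p v -> u = v.
  by case: chp => _ + _; apply.
have Ks : (p @` [set t | -1 <= t <= 1]) (g s) by rewrite gs; exists r => //=; lra.
have [t1 [t1I [r1 /= r1I pr1] hit]] :=
  first_hit cg (closed_path hX (a := -1) (b := 1) cp) (ltW s0) Ks.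
have [q [chq q0 qG [r2 [r2I qr2]] qK]] : exists q : R -> X, [/\ chart q, q 0 = z,
    forall t, (Q `&` ~` (phi @` [set t | -1 <= t <= 0])) (q t),
    exists r2, -1 <= r2 <= 0 /\ q r2 = g t1 &
    forall t, -1 <= t <= 1 -> (p @` [set t | -1 <= t <= 1]) (q t)].
  have [r1n|r1p] := leP r1 0.
    by exists p; split => //; exists r1; split => //; lra.
  exists (fun t => p (- t)); split => //; first exact: chart_opp.
  - by rewrite oppr0.
  - by exists (- r1); rewrite opprK; split => //; lra.
  - by move=> t tI; exists (- t) => //=; lra.
have [cq iq _] := chq.
have r2n : r2 < 0.
  rewrite lt_neqAle; apply/andP; split; last lra.
  apply/eqP => r20; apply: nz; exists (g, T) => //; exists t1 => /=; first lra.
  by rewrite -qr2 r20.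
pose h := continue_along g t1 q r2.
have hr u : 0 <= u -> h (t1 + u) = q (r2 + u) by apply: continue_along_r.
have rh : ray (h, t1 - r2 + 1 / 2).
  split => /=.
  - by apply: continue_along_continuous.
  - lra.
  - by move=> t tI; rewrite /h continue_along_l ?gphi //; lra.
  - move=> u v uI vI; apply: (continue_along_inj chq (a := -1) (r' := 1)); rewrite -?qr2 //; [|lra|lra| |lra|lra].
      by move=> *; apply: ig => //; lra.
    move=> t w tI wI gq; have [t0|t0] := ltP t 0.
      by case: (qG w) => _; apply; rewrite -gq gphi; [exists t => //=; lra|lra].
    by apply: (hit t); [lra|rewrite gq; apply: qK; lra].
  - move=> t tI; have [tt1|tt1] := leP t t1.
      by rewrite /h continue_along_l //; apply: gQ; lra.
    have -> : t = t1 + (t - t1) by lra.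
    by rewrite hr; [case: (qG (r2 + (t - t1)))|lra].
apply: nz; exists (h, t1 - r2 + 1 / 2) => //; exists (t1 + (- r2)) => /=; first lra.
by rewrite hr; [rewrite subrr|lra].
Qed.

Hypothesis kX : compact [set: X].

(** If no ray came back to the chart from behind [phi (-1)], the traces of the
   rays would be an open cover, directed by inclusion, of the compact closure
   of their union, and one of them would contain its own end. *)
Lemma ray_returns : exists g T u, [/\ ray (g, T), -2 < u < -1 & g T = phi u].
Proof.
pose F : set_system ((R -> X) * R) :=
  filter_from ray (fun x => [set y | ray y /\ trace x `<=` trace y]).
have FF : Filter F.
  apply: filter_from_filter; first by exists (phi, 1); exact: ray_chart.
  move=> x y rx ry; case: (trace_nested rx ry) => xy.
    by exists y => // z [rz yz]; split; split => //; exact: subset_trans yz.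
  by exists x => // z [rz yz]; split; split => //; exact: subset_trans yz.
have kc : compact (closure reach) by apply: (subclosed_compact _ kX) => //; exact: closed_closure.
pose P (x : (R -> X) * R) z := ray x /\ (trace x `|` phi @` [set t | -2 < t < 0]) z.
have := (compact_near_coveringP _).1 kc _ F P FF.
have ophi : open (phi @` [set t | -2 < t < 0]) by apply: chart_open => //; lra.
case=> [z clz|x rx].
  have [zv|zv] := pselect (z = phi (-1)).
    exists (phi @` [set t | -2 < t < 0], ray) => /=.
      split; first by apply: open_nbhs_nbhs; split => //; rewrite zv; exists (-1) => //=; lra.
      by exists (phi, 1); [exact: ray_chart|move=> ? []].
    by move=> [w x] /= [ww rx]; split => //; right.
  have [x rx xz] := reach_closed clz zv.
  exists (trace x, [set y | ray y /\ trace x `<=` trace y]) => /=.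
    by split; [apply: open_nbhs_nbhs; split => //; exact: open_trace|exists x].
  by move=> [w y] /= [xw [ry xy]]; split => //; left; exact: xy.
move=> /(_ x (conj rx (@subset_refl _ _))) cover; case: x rx cover => g T rg cover.
have [/= cg T0 gphi ig gQ] := rg.
have N1 : -1 <= (-1 : R) <= 0 by rewrite lexx lerN10.
have clT : closure reach (g T).
  move=> B /cg /nbhs_ballP [e /= e0 eB].
  pose s := T - Num.min (e / 2) (T / 2).
  have m0 : 0 < Num.min (e / 2) (T / 2) by rewrite lt_min; apply/andP; split; lra.
  have [m1 m2] : Num.min (e / 2) (T / 2) <= e / 2 /\ Num.min (e / 2) (T / 2) <= T / 2.
    by rewrite !ge_min !lexx ?orbT.
  exists (g s); split; last first.
    by apply: eB; rewrite /ball /= /s opprB addrC subrK gtr0_norm //; lra.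
  by exists (g, T) => //; exists s => //=; rewrite /s; lra.
have [_ [[t /= tI /ig tT]|[u /= uI uT]]] := cover _ clT.
  by have := tT _ _; lra.
exists g, T, u; split => //; apply/andP; split; first lra.
rewrite ltNge; apply/negP => u1; have uI' : -1 <= u <= 0 by lra.
by move: uT; rewrite -(gphi _ uI') => /ig uT; have := uT _ _; lra.
Qed.

(** A ray that returns is closed up: it is followed until it first meets the arc
   of [phi] behind [phi (-1)], and then along that arc to [phi (-1)]. *)
Lemma exists_loop : exists g b, [/\ continuous g, 0 < b,
  forall s t, -1 <= s < b -> -1 <= t < b -> g s = g t -> s = t,
  g (-1) = g b & g 0 = phi 0] /\ clopen (g @` [set t | -1 <= t <= b]).
Proof.
have [g [T [u [rg uI gT]]]] := ray_returns.
have [/= cg T0 gphi ig gQ] := rg.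
have N1 : -1 <= (-1 : R) <= 0 by rewrite lexx lerN10.
have KT : (phi @` [set t | u <= t <= -1]) (g T) by rewrite gT; exists u => //=; lra.
have [t1 [t1I [u1 /= u1I gt1] hit]] :=
  first_hit cg (closed_path hX (a := u) (b := -1) cphi) (ltW T0) KT.
have u1n : u1 < -1.
  rewrite lt_neqAle; apply/andP; split; last lra.
  apply/eqP => e; move: gt1; rewrite e -(gphi _ N1) => /ig e'.
  by have := e' _ _; lra.
pose b := t1 + (-1 - u1).
pose f := continue_along g t1 phi u1.
have fr s : 0 <= s -> f (t1 + s) = phi (u1 + s) by apply: continue_along_r.
have fl s : s <= t1 -> f s = g s by apply: continue_along_l.
have cf : continuous f by apply: continue_along_continuous.
have fb : f (-1) = f b.
  rewrite fl; last lra.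
  by rewrite fr ?(gphi _ N1); [congr phi|]; lra.
have jf s t : -1 <= s < b -> -1 <= t < b -> f s = f t -> s = t.
  apply: (continue_along_inj ch (a := -1) (r' := -1)) => //; [|lra|lra|].
    by move=> v w vI wI; apply: ig; lra.
  move=> v w vI wI gw; have [v0|v0] := ltP v 0.
    have vI0 : -1 <= v <= 0 by lra.
    have : v = w by apply: iphi; [lra|lra|rewrite -gw gphi].
    lra.
  by apply: (hit v); [lra|rewrite gw; exists w => //=; lra].
exists f, b; split.
  by split => //; [rewrite /b; lra|rewrite fl ?gphi //; lra].
split; last exact: closed_path.
rewrite (_ : _ @` _ = f @` [set t | -1 < t < b] `|` phi @` [set t | u1 < t < 0]).
  apply: openU; last by apply: chart_open => //; lra.
  apply: (open_curve hX cf).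
    by move=> s t sI tI; apply: jf; lra.
  move=> t tI; apply: QO; have [tt|tt] := leP t t1; first by rewrite fl //; apply: gQ; lra.
  have -> : t = t1 + (t - t1) by lra.
  by rewrite fr; [exact: phiQ|lra].
have m1 : (phi @` [set t | u1 < t < 0]) (f (-1)).
  by rewrite fl ?gphi //; [exists (-1) => //=|]; lra.
apply/seteqP; split=> [_ [t /= tI <-]|_ [[t /= tI <-]|[t /= tI <-]]].
- have [->|t1'] := eqVneq t (-1); first by right.
  have [->|tb] := eqVneq t b; first by rewrite -fb; right.
  left; exists t => //=; rewrite !lt_neqAle (eq_sym (-1)) t1' tb /=; lra.
- by exists t => //=; lra.
have [tn|tn] := leP t (-1).
  exists (t1 + (t - u1)) => /=; first by rewrite /b; lra.
  by rewrite fr; [congr phi|]; lra.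
by exists t => /=; [rewrite /b; lra|rewrite fl ?gphi //; lra].
Qed.

End Rays.

(** * Compact one-dimensional manifolds are unions of circles *)

Section Circle.
Context {R : realType} {X : topologicalType}.
Hypothesis hX : hausdorff_space X.

Lemma homeomorphic_loop (g : R -> X) a b : continuous g -> a < b ->
    (forall s t, a <= s < b -> a <= t < b -> g s = g t -> s = t) -> g a = g b ->
  homeomorphic (g @` [set t | a <= t <= b]) (unit_circle R).
Proof.
move=> cg ab ig gab.
(* With w = sin (theta / 2) this is the point of angle pi - theta: an algebraic
   parametrization of the circle by [-1, 1]. *)
pose w t : R := (2 * t - a - b) / (b - a).
pose e t : R * R := (2 * w t ^+ 2 - 1, 2 * w t * Num.sqrt (1 - w t ^+ 2)).
have ba0 : b - a != 0 by rewrite gt_eqF // subr_gt0.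
have wI t : a <= t <= b -> -1 <= w t <= 1.
  by move=> tI; rewrite /w ler_pdivlMr ?ler_pdivrMr; lra.
have tE t : t = (w t * (b - a) + a + b) / 2 by rewrite /w divfK //; lra.
have winj s t : w s = w t -> s = t by move=> st; rewrite (tE s) (tE t) st.
have cw : continuous w.
  by move=> t; apply: cvgM; [do 2 (apply: cvgB; last exact: cvg_cst);
    apply: cvgM; [exact: cvg_cst|exact: cvg_id]|exact: cvg_cst].
have cw2 : continuous (fun t => w t ^+ 2).
  by move=> t; exact: cvgM (cw t) (cw t).
have ce1 : continuous (fun t => 2 * w t ^+ 2 - 1).
  by move=> t; apply: cvgB; [apply: cvgM; [exact: cvg_cst|exact: cw2]|exact: cvg_cst].
have ce2 : continuous (fun t => 2 * w t * Num.sqrt (1 - w t ^+ 2)).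
  move=> t; apply: cvgM; first by apply: cvgM; [exact: cvg_cst|exact: cw].
  apply: (@continuous_comp _ _ _ (fun t => 1 - w t ^+ 2) Num.sqrt).
    by apply: cvgB; [exact: cvg_cst|exact: cw2].
  exact: sqrt_continuous.
have ce : continuous e by move=> t; exact: cvg_pair (ce1 t) (ce2 t).
have sq1 v : -1 <= v <= 1 -> 0 <= 1 - v ^+ 2 :> R by move=> vI; nra.
rewrite (_ : unit_circle R = e @` [set t | a <= t <= b]).
  apply: homeomorphic_quotient => //; first exact: compact_cc.
  have end_eq s t : a <= s <= b -> a <= t <= b -> g s = g t ->
      s = t \/ (s = a /\ t = b) \/ (s = b /\ t = a).
    move=> sI tI gst.
    have [sb|sb] := ltP s b; have [tb|tb] := ltP t b.
    - by left; apply: ig gst; lra.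
    - have tE' : t = b by lra.
      have : s = a by apply: ig; [lra|lra|rewrite gst tE' gab].
      by right; left.
    - have sE' : s = b by lra.
      have : t = a by apply: ig; [lra|lra|rewrite -gst sE' gab].
      by right; right.
    - by left; lra.
  have wa : w a = -1.
    by rewrite /w (_ : 2 * a - a - b = - (b - a)) ?mulNr ?mulfV //; lra.
  have wb : w b = 1 by rewrite /w (_ : 2 * b - a - b = b - a) ?mulfV //; lra.
  have eab : e a = e b.
    by rewrite /e wa wb sqrrN expr1n subrr sqrtr0 !mulr0.
  move=> s t sI tI; split=> [/(end_eq _ _ sI tI) [->|[[-> ->]|[-> ->]]] //|].
  move=> [e1 e2].
  have w2 : w s ^+ 2 = w t ^+ 2 by lra.
  have [/winj -> //|ne] := eqVneq (w s) (w t).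
  have ws : w s = - w t.
    by move/eqP: w2; rewrite eqf_sqr (negbTE ne) => /eqP.
  move: e2; rewrite ws sqrrN.
  move: ne; rewrite ws => ne e2.
  have wt0 : w t != 0 by apply: contraNN ne => /eqP ->; rewrite oppr0.
  have : w t * Num.sqrt (1 - w t ^+ 2) = 0 by lra.
  move=> /eqP; rewrite mulf_eq0 (negbTE wt0) /= sqrtr_eq0 => le0.
  have : w t ^+ 2 = 1 by have := sq1 _ (wI _ tI); lra.
  move=> /eqP; rewrite sqrf_eq1 => /orP[] /eqP wt.
    have -> : t = b by apply: winj; rewrite wt wb.
    by have -> : s = a by apply: winj; rewrite ws wt wa.
  have -> : t = a by apply: winj; rewrite wt wa.
  by have -> : s = b by apply: winj; rewrite ws wt wb opprK.
apply/seteqP; split=> [[x y]|_ [t /= tI <-]]; rewrite /unit_circle /=; last first.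
  have := sqr_sqrtr (sq1 _ (wI _ tI)); move: (Num.sqrt _) => z.
  by move: (w t) => v zE; rewrite [(_ * z) ^+ 2]exprMn zE; ring.
move=> xy.
have x1 : -1 <= x <= 1 by apply/andP; split; nra.
have h0 : 0 <= (1 + x) / 2 by lra.
pose v : R := if 0 <= y then Num.sqrt ((1 + x) / 2) else - Num.sqrt ((1 + x) / 2).
have v2 : v ^+ 2 = (1 + x) / 2 by rewrite /v; case: ifP => _; rewrite ?sqrrN sqr_sqrtr.
have vI : -1 <= v <= 1 by apply/andP; split; nra.
exists ((v * (b - a) + a + b) / 2); first by rewrite /=; apply/andP; split; nra.
have wE : w ((v * (b - a) + a + b) / 2) = v.
  rewrite /w (_ : _ - b = v * (b - a)) ?mulfK //; lra.
rewrite /e wE v2; congr pair; first by lra.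
have zE := sqr_sqrtr (_ : 0 <= 1 - (1 + x) / 2); rewrite -/(Num.sqrt _).
have {}zE := zE _; set z := Num.sqrt _ in zE *.
have z0 : 0 <= z by exact: sqrtr_ge0.
have {}zE : z ^+ 2 = 1 - (1 + x) / 2 by apply: zE; lra.
have y2 : (2 * v * z) ^+ 2 = y ^+ 2 by rewrite !exprMn v2 zE; lra.
move/eqP: y2; rewrite eqf_sqr => /orP[] /eqP // yv.
have : y = 0.
  move: yv; rewrite /v; have := sqrtr_ge0 ((1 + x) / 2).
  by move: (Num.sqrt _) => q q0; case: (leP 0 y) => y0 yv; nra.
by move=> y0; rewrite yv y0 oppr0.
Qed.

(** The classification of compact one-dimensional manifolds: the loop through
   [x] obtained by following rays is clopen and homeomorphic to the circle. *)
Lemma clopen_arc_points_circle (Q : set X) : compact [set: X] -> clopen Q ->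
  Q `<=` arc_points R X -> Q `<=` circle_points R X.
Proof.
move=> kX cQ QO x Qx.
have Qn : nbhs x Q by apply: open_nbhs_nbhs; split => //; case: cQ.
have [p [ch p0 pQ]] := exists_chart (QO _ Qx) Qn.
have [g [b [[cg b0 ig gb g0] gc]]] := exists_loop hX cQ QO ch pQ kX.
exists (g @` [set t | -1 <= t <= b]); split => //.
  by exists 0 => /=; [lra|rewrite g0].
by apply: homeomorphic_loop => //; lra.
Qed.

End Circle.

(** * Homeomorphisms close to the identity away from C *)

Section Barrier.
Context {R : realType} {X : topologicalType} {d : X -> X -> R}.
Hypothesis md : compatible_metric d.
Hypothesis cX : compact [set: X].
Implicit Types (A C F U V : set X) (h : homeo X).

Definition kC_filter C : set_system (homeo X) :=
  filter_from [set e : R | 0 < e] (B_kC d C).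

Lemma B_kC_anti C e r : e <= r -> B_kC d C e `<=` B_kC d C r.
Proof.
move=> er h hB x nx; have [|h1 h2] := hB x; last by split; lra.
by move=> /metric_nbhdP [c Cc xc]; apply: nx; apply/metric_nbhdP; exists c => //; lra.
Qed.

Lemma kC_filter_filter C : Filter (kC_filter C).
Proof.
apply: filter_from_filter; first by exists 1 => /=.
move=> e r /= e0 r0; exists (Num.min e r); first by rewrite /= lt_min e0.
by move=> h hB; split; apply: B_kC_anti hB; rewrite ge_min lexx ?orbT.
Qed.

Lemma B_kC_inv C e h : B_kC d C e h -> B_kC d C e (h^-1)%g.
Proof. by move=> hB x /hB; rewrite invgK => -[]. Qed.

(** Around a part [A] of [C] that is clopen in [C], homeomorphisms near the
   identity off [C] hardly move a shell that separates [A] from the rest of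
   [C].  Hence no component crosses the boundary of the set of points near [A]
   that are sent away from [A]. *)
Lemma barrier C A F : closed A -> closed F -> A `&` F = set0 -> C `<=` A `|` F ->
  exists U V, [/\ open U, open V, A `<=` U, F `<=` V & U `&` F = set0] /\
    kC_filter C [set h | exists Q, [/\ clopen Q, Q `<=` U,
      (forall a, U a -> V (h a) -> Q a) & forall b, Q b -> ~ U (h b)]].
Proof.
move=> cA cF AF CAF.
have [r r0 rP] := separation_radius md (closed_compactX cX cA) cF AF.
pose near_set (B : set X) s := [set x | exists2 c, B c & d x c < s].
pose e := r / 4; have e0 : 0 < e by rewrite /e; lra.
exists (near_set A e), (near_set F e); split.
  split; try exact: open_near_set.
  - by move=> x Ax; exists x => //; rewrite (metric_refl md).
  - by move=> x Ax; exists x => //; rewrite (metric_refl md).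
  - apply/seteqP; split=> // x [[c Ac xc] Fx].
    by have := rP _ _ Ac Fx; rewrite (metric_sym md); rewrite /e in xc e0; lra.
exists (e / 2) => /=; first lra.
move=> h hB.
have far x a : A a -> d x a < 3 * e -> ~ near_set A (e / 2) x ->
    ~ metric_nbhd d C (e / 2) x.
  move=> Aa xa nx /metric_nbhdP [c /CAF [Ac|Fc] xc]; first by apply: nx; exists c.
  have := rP _ _ Aa Fc; have := metric_tri md x a c.
  by rewrite (metric_sym md a x); rewrite /e in xa xc e0; lra.
have grow s t x : s <= t -> near_set A s x -> near_set A t x.
  by move=> st [c Ac xc]; exists c => //; lra.
have inner b : near_set A e b -> ~ near_set A (2 * e) (h b) -> near_set A (e / 2) b.
  move=> [a Aa ba] nhb; apply: contrapT => nb; apply: nhb.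
  have ba3 : d b a < 3 * e by lra.
  have [hb _] := hB _ (far _ _ Aa ba3 nb).
  by exists a => //; have := metric_tri md b (h b) a; lra.
have outer b : near_set A e b -> ~ near_set A (2 * e) (h b) ->
    ~ near_set A (3 * e) (h b).
  move=> [a Aa ba] nhb [a' Aa' hba]; apply: (nhb).
  have nb : ~ near_set A (e / 2) (h b).
    by move=> nb; apply: nhb; apply: grow nb; lra.
  have [_] := hB _ (far _ _ Aa' hba nb); rewrite homeoVK => bh.
  exists a => //; have := metric_tri md b (h b) a.
  by rewrite (metric_sym md (h b) b); lra.
exists [set b | near_set A e b /\ ~ near_set A (2 * e) (h b)]; split.
- split.
    rewrite openE => b [nb nhb]; have nb3 := outer _ nb nhb.
    apply: filterI; first by apply: open_nbhs_nbhs; split => //; exact: open_near_set.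
    have : nbhs b (h @^-1` [set y | d (h b) y < e]).
      by apply: homeo_nbhs; exact: nbhs_metric_ball.
    apply: filterS => y /= hby [c Ac yc]; apply: nb3; exists c => //.
    by have := metric_tri md (h y) (h b) c; lra.
  rewrite -openC openE => b nQb.
  have [nb|nb] := pselect (near_set A e b).
    have hb : near_set A (2 * e) (h b).
      by apply: contrapT => nhb; apply: nQb.
    have : nbhs b (h @^-1` near_set A (2 * e)).
      by apply: homeo_nbhs; apply: open_nbhs_nbhs; split => //; exact: open_near_set.
    by apply: filterS => y /= hy [_ /(_ hy)].
  have e20 : 0 < e / 2 by lra.
  apply: filterS (nbhs_metric_ball md b e20) => y /= byl [ny nhy].
  have [c Ac yc] := inner _ ny nhy; apply: nb; exists c => //.
  by have := metric_tri md y b c; lra.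
- by move=> b [].
- move=> a Ua [f Ff haf]; split => // -[c Ac hac].
  have := rP _ _ Ac Ff; have := metric_tri md (h a) c f.
  by rewrite (metric_sym md c (h a)); rewrite /e in hac haf e0; lra.
- by move=> b [_ nhb] Uhb; apply: nhb; apply: grow Uhb; lra.
Qed.

End Barrier.

Section Separation.
Context {R : realType} {X : topologicalType} {d : X -> X -> R}.
Hypothesis md : compatible_metric d.
Hypothesis cX : compact [set: X].
Hypothesis denseO : dense (arc_points R X).
Let O : set X := arc_points R X.
Let C : set X := ~` O.
Let S : set X := circle_points R X.
Hypothesis S1 : is_subset1 (closure S `&` C).
Implicit Types (x y a b : X) (h : homeo X).

Let closedC : closed C. Proof. by apply: open_closedC; exact: open_arc_points. Qed.

Lemma homeo_C h x : C x -> C (h x).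
Proof. by move=> Cx /arc_points_homeoE. Qed.

(** The displacement has to be controlled only from near one point of [C] to
   near another one.  Points of [S] are left out: they accumulate at one point
   of [C] at most, so they cannot be close to two points of [C]. *)
Definition separated_points x y := exists U V, [/\ nbhs x U, nbhs y V &
  kC_filter (d := d) C [set h | forall a, U a -> ~ S a -> ~ V (h a)]].

Lemma separated_points_sym x y : separated_points x y -> separated_points y x.
Proof.
move=> [U [V [Ux Vy [e e0 eP]]]]; exists V, U; split => //; exists e => //.
move=> h /B_kC_inv /eP hUV b Vb Sb Uhb.
by apply: (hUV (h b)) => //; [move=> /circle_points_homeoE|rewrite homeoVK].
Qed.

Lemma C_not_open x U : nbhs x U -> C x -> exists a, [/\ U a, O a & a <> x].
Proof.
rewrite nbhsE => -[W [oW Wx] WU] Cx.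
have [|a [Wa Oa]] := denseO _ oW; first by exists x.
by exists a; split => //; [exact: WU|move=> ax; apply: Cx; rewrite -ax].
Qed.

(** A pair of points at distance at least [e] that is not in [C] x [C] cannot
   be a point and its image, by the definition of [B_kC] applied to the
   homeomorphism or to its inverse; compactness of [X] x [X] then makes the
   local estimates uniform. *)
Lemma uniform_of_separated :
    (forall x y, C x -> C y -> x <> y -> separated_points x y) ->
  forall e, 0 < e -> exists2 r, 0 < r &
    forall h, B_kC d C r h -> forall x, d (h x) x < e.
Proof.
move=> sep e e0; have FF := kC_filter_filter (d := d) C.
pose P h (z : X * X) := d z.1 z.2 < e \/ h z.1 <> z.2.
have off x : ~ C x -> exists r, [/\ 0 < r, r <= e / 4 &
    forall y, d x y < r -> ~ metric_nbhd d C r y].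
  move=> nC; have /(nbhs_metric md) [r r0 rP] : nbhs x (~` C).
    by apply: open_nbhs_nbhs; split; [exact: closed_openC|].
  exists (Num.min (r / 2) (e / 4)); split.
  - by rewrite lt_min; apply/andP; split; lra.
  - by rewrite ge_min lexx orbT.
  move=> y; rewrite lt_min => /andP[xy _] /metric_nbhdP [c Cc].
  rewrite lt_min => /andP[yc _]; apply: (rP c) => //.
  by have := metric_tri md y x c; lra.
have cXX : compact [set: X * X] by rewrite -setXTT; exact: compact_setX.
have := (compact_near_coveringP _).1 cXX _ _ P FF.
case=> [[x y] _|r r0 rP]; last first.
  exists r => // h /rP hP x; have /= := hP (x, h x) Logic.I.
  by case=> //=; rewrite (metric_sym md).
have box A B H : nbhs x A -> nbhs y B -> kC_filter (d := d) C H ->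
    (forall a b h, A a -> B b -> H h -> P h (a, b)) ->
    \forall z \near (x, y) & h \near kC_filter (d := d) C, P h z.
  move=> Ax By FH hP; exists (A `*` B, H) => /=; first by split => //; exists (A, B).
  by move=> [[a b] h] /= [[Aa Bb] Hh]; exact: hP.
have ball z r : 0 < r -> nbhs z [set w | d z w < r] by exact: nbhs_metric_ball.
have fB r : 0 < r -> kC_filter (d := d) C (B_kC d C r) by exists r.
have [xy|xy] := ltP (d x y) e.
  have r0 : 0 < (e - d x y) / 2 by lra.
  apply: (box _ _ setT (ball x _ r0) (ball y _ r0) filterT) => a b h /= xa yb _.
  left => /=; have := metric_tri md x a b; have := metric_tri md y x b.
  by rewrite (metric_sym md a x); lra.
have e40 : 0 < e / 4 by lra.
have [Cx|nCx] := pselect (C x); last first.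
  have [r [r0 re rP]] := off _ nCx.
  apply: (box _ _ _ (ball x _ r0) (ball y _ e40) (fB _ r0)) => a b h /= xa yb hB.
  right => /= hab; have [] := hB a (rP _ xa); rewrite hab => ba _.
  have := metric_tri md a x y; have := metric_tri md b a y.
  by rewrite (metric_sym md a b) (metric_sym md b y); lra.
have [Cy|nCy] := pselect (C y); last first.
  have [r [r0 re rP]] := off _ nCy.
  apply: (box _ _ _ (ball x _ e40) (ball y _ r0) (fB _ r0)) => a b h /= xa yb hB.
  right => /= hab; have [_] := hB b (rP _ yb); rewrite -hab homeoVK => ab.
  have := metric_tri md a x y; have := metric_tri md b a y.
  by rewrite hab in ab; rewrite (metric_sym md b y); lra.
have xy_neq : x <> y by move=> xy'; move: xy; rewrite xy' (metric_refl md); lra.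
have [U [V [Ux Vy FUV]]] := sep _ _ Cx Cy xy_neq.
have [nSx|nSy] : ~ closure S x \/ ~ closure S y.
  by apply/not_andP => -[Sx Sy]; apply: xy_neq; exact: S1.
  have Wx : nbhs x (U `&` ~` closure S).
    apply: filterI => //; apply: open_nbhs_nbhs.
    by split => //; apply: closed_openC; exact: closed_closure.
  apply: (box _ _ _ Wx Vy FUV) => a b h /= [Ua nSa] Vb hUV; right => /= hab.
  apply: (hUV a) => //; last by rewrite hab.
  by move=> Sa; apply: nSa; exact: subset_closure.
have Wy : nbhs y (V `&` ~` closure S).
  apply: filterI => //; apply: open_nbhs_nbhs.
  by split => //; apply: closed_openC; exact: closed_closure.
apply: (box _ _ _ Ux Wy FUV) => a b h /= Ua [Vb nSb] hUV; right => /= hab.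
apply: (hUV a) => //; last by rewrite hab.
move=> Sa; apply: nSb; apply: subset_closure; rewrite -hab.
exact/circle_points_homeoE.
Qed.

Let closed1 x : closed [set x].
Proof. exact: compact_closed (metric_hausdorff md) (@compact_set1 _ x). Qed.

(** A point [a] near [x] sent near [y] would lie in a clopen set [Q] around [a]
   that contains no point of [C] but possibly [x].  If [Q] misses [x], it is a
   compact one-dimensional manifold, so [a] lies on a circle.  If [Q] contains
   [x], then [x] is moved away from itself, which is impossible when [x] is the
   limit point of [S]; and when it is not, [Q] can be excluded beforehand. *)
Lemma separated_isolated x y : C x -> C y -> x <> y -> closed (C `\ x) ->
  separated_points x y.
Proof.
move=> Cx Cy xy cCx; have kX := metric_hausdorff md.
have circle Q : clopen Q -> Q `<=` O -> Q `<=` S.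
  exact: (clopen_arc_points_circle kX cX).
have [Sx|nSx] := pselect (closure S x).
  have disj : [set x] `&` (C `\ x) = set0.
    by apply/seteqP; split=> // z [-> [_]]; apply.
  have cov : C `<=` [set x] `|` (C `\ x).
    by move=> z Cz; have [->|zx] := pselect (z = x); [left|right].
  have [U [V [[oU oV xU FV UF] [e e0 eP]]]] := barrier md cX (closed1 (x := x)) cCx disj cov.
  exists U, V; split; [apply: open_nbhs_nbhs; split => //; exact: xU| |].
    by apply: open_nbhs_nbhs; split => //; apply: FV; split => // yx; apply: xy.
  exists e => // h /eP [Q [cQ QU UVQ hQU]] a Ua nSa Vha.
  have Qa := UVQ _ Ua Vha.
  have Qx : Q x.
    apply: contrapT => nQx; apply: nSa; apply: (circle Q) => // b Qb.
    apply: contrapT => nOb; rewrite -[False]/(set0 b) -UF; split; first exact: QU.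
    by split => // bx; apply: nQx; rewrite -bx.
  apply: (hQU _ Qx); rewrite (S1 (x := h x) (y := x)) => //; first exact: xU.
  by split; [exact: closure_circle_points_homeo|exact: homeo_C].
(* If a clopen set cut x out of C and the circles, then so would a smaller one,
   and the difference would consist of circles. *)
have [q qx qP] : exists2 q, q <> x & forall Q, clopen Q -> Q x ->
    Q `&` (C `\ x `|` closure S `|` [set q]) <> set0.
  have [[Q1 [cQ1 Q1x Q1F]]|nQ1] := pselect (exists Q1, [/\ clopen Q1, Q1 x &
      Q1 `&` (C `\ x `|` closure S) = set0]); last first.
    exists y => [yx|Q cQ Qx QF]; first exact: xy.
    apply: nQ1; exists Q; split => //; apply/seteqP; split=> // z [Qz Fz].
    by rewrite -QF; split => //; left.
  have [|q [Q1q Oq qx]] := @C_not_open x Q1 _ Cx.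
    by apply: open_nbhs_nbhs; split => //; case: cQ1.
  exists q => // Q cQ Qx QF.
  have Sq : S q.
    apply: (circle (Q1 `\` Q)).
    - rewrite setDE; split; [apply: openI|apply: closedI]; case: cQ1 => // _ _.
        by apply: closed_openC; case: cQ.
      by apply: open_closedC; case: cQ.
    - move=> b [Q1b nQb]; apply: contrapT => nOb.
      rewrite -[False]/(set0 b) -Q1F; split => //; left; split => // bx.
      by apply: nQb; rewrite bx.
    - split => // Qq; rewrite -[False]/(set0 q) -QF; split => //.
      by right.
  rewrite -[False]/(set0 q) -Q1F; split => //; right; exact: subset_closure.
pose F := C `\ x `|` closure S `|` [set q].
have cF : closed F.
  by apply: closedU => //; apply: closedU => //; exact: closed_closure.
have disj : [set x] `&` F = set0.
  apply/seteqP; split=> // z [-> [[[_]|]|xq]]; [by apply|by []|].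
  by apply: qx.
have cov : C `<=` [set x] `|` F.
  by move=> z Cz; have [->|zx] := pselect (z = x); [left|right; left; left].
have [U [V [[oU oV xU FV UF] [e e0 eP]]]] := barrier md cX (closed1 (x := x)) cF disj cov.
exists U, V; split; [apply: open_nbhs_nbhs; split => //; exact: xU| |].
  apply: open_nbhs_nbhs; split => //; apply: FV; left; left; split => // yx.
  exact: xy.
exists e => // h /eP [Q [cQ QU UVQ hQU]] a Ua nSa Vha.
have QF b : Q b -> ~ F b.
  by move=> Qb Fb; rewrite -[False]/(set0 b) -UF; split => //; exact: QU.
have [Qx|nQx] := pselect (Q x).
  by apply: (qP _ cQ Qx); apply/seteqP; split=> // z [/QF].
apply: nSa; apply: (circle Q) => //; last exact: UVQ.
move=> b Qb; apply: contrapT => nOb; apply: (QF _ Qb); left; left.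
by split => // bx; apply: nQx; rewrite -bx.
Qed.

(** As there are finitely many components off [S], the one of [x] is a
   neighbourhood of [x]; it contains an arc point [q].  A clopen set that meets
   it contains it, hence contains [q], so it is not confined near [x]. *)
Lemma separated_component x y : clopen_base C -> finite_set (components (~` S)) ->
  C x -> C y -> x <> y -> ~ closure S x -> separated_points x y.
Proof.
move=> base fin Cx Cy xy nSx.
pose P := connected_component (~` S) x.
pose others := \bigcup_(P' in components (~` S) `\ P) P'.
have cS : closed (~` S) by apply: open_closedC; exact: open_circle_points.
have cothers : closed others.
  apply: closed_bigcup; first exact: finite_setD.
  by move=> _ [[b _ <-] _]; exact: component_closed.
have nSx' : ~ S x by move=> Sx; apply: nSx; exact: subset_closure.
have nx : ~ others x.
  move=> [_ [[b nSb <-] bP] bx]; apply: bP.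
  by apply/esym/same_connected_component; exact: connected_component_sym.
pose N := ~` closure S `&` ~` others.
have Nx : nbhs x N.
  apply: open_nbhs_nbhs; split => //; apply: openI; apply: closed_openC => //.
  exact: closed_closure.
have NP a : N a -> P a.
  move=> [nSa na]; apply: contrapT => nPa; apply: na.
  have nSa' : (~` S) a by move=> Sa; apply: nSa; exact: subset_closure.
  exists (connected_component (~` S) a); last exact: connected_component_refl.
  split; first by exists a.
  by move=> aP; apply: nPa; rewrite -aP; exact: connected_component_refl.
have [q [Nq Oq qx]] := C_not_open Nx Cx.
have [A [cA cCA Ax nAy AC]] : exists A, [/\ closed A, closed (C `\` A), A x, ~ A y &
    A `<=` C].
  pose c := in_set_type Cx.
  have nc : nbhs c (set_val @^-1` (~` [set y])).
    apply: (@continuous_set_val _ C c); apply: open_nbhs_nbhs.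
    by split; [exact: closed_openC (@closed1 y)|exact: xy].
  have [V [[oV cV] Vc VU]] := base c _ nc.
  case: oV => B oB BV; move: cV; rewrite -openC => -[B' oB' BV'].
  have BE z (Cz : C z) : B z <-> V (in_set_type Cz) by rewrite -BV.
  have BE' z (Cz : C z) : B' z <-> ~ V (in_set_type Cz).
    by rewrite -[~ V _]/((~` V) _) -BV'.
  exists (C `&` B); split.
  - rewrite (_ : C `&` B = C `&` ~` B'); last first.
      apply/seteqP; split=> z [Cz] Bz; split => //.
        by move=> /(BE' _ Cz); apply; apply/BE.
      by apply/(BE _ Cz); apply: contrapT => /(BE' _ Cz).
    by apply: closedI => //; exact: open_closedC.
  - rewrite (_ : C `\` _ = C `&` ~` B); first by apply: closedI => //; exact: open_closedC.
    apply/seteqP; split=> z [Cz nB]; (split; first exact: Cz).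
      by move=> Bz; apply: nB.
    by case.
  - by split => //; apply/(BE _ Cx).
  - by move=> [_ /(BE _ Cy) /VU]; apply.
  - by move=> z [].
pose F := C `\` A `|` [set q].
have cF : closed F by apply: closedU.
have disj : A `&` F = set0.
  apply/seteqP; split=> // z [Az [[_ nAz]|zq]]; first exact: nAz.
  by have := AC _ Az; rewrite zq; apply.
have cov : C `<=` A `|` F.
  by move=> z Cz; have [|] := pselect (A z); [left|right; left].
have [U [V [[oU oV AU FV UF] [e e0 eP]]]] := barrier md cX cA cF disj cov.
exists (U `&` N), V; split.
- by apply: filterI => //; apply: open_nbhs_nbhs; split => //; exact: AU.
- by apply: open_nbhs_nbhs; split => //; apply: FV; left.
exists e => // h /eP [Q [[oQ cQ] QU UVQ hQU]] a [Ua Na] nSa Vha.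
have Qa := UVQ _ Ua Vha.
have PQ : P `&` Q = P.
  apply: (@component_connected _ (~` S) x).
  - by exists a; split => //; exact: NP.
  - by exists Q.
  - by exists Q.
have : (P `&` Q) q by rewrite PQ; exact: NP.
move=> [_ Qq]; rewrite -[False]/(set0 q) -UF; split; first exact: QU.
by right.
Qed.

End Separation.

(** * The two cases *)

(** At most one of two distinct points is the limit of the sequence. *)
Lemma convergent_sequence_isolated (R : realType) (X : topologicalType)
    (C : set X) (x y : X) :
  closed C -> convergent_sequence R C -> C x -> C y -> x <> y ->
  closed (C `\ x) \/ closed (C `\ y).
Proof.
move=> cC [f [g [cf cg fK gK]]] Cx Cy xy.
pose A := [set 0 : R] `|` [set n.+1%:R^-1 | n in [set: nat]].
suff iso z (Cz : C z) n : set_val (f (in_set_type Cz)) = n.+1%:R^-1 :> R ->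
    closed (C `\ z).
  have [x0|[n _ xn]] : A (set_val (f (in_set_type Cx))) by exact: set_valP.
    have [y0|[n _ yn]] : A (set_val (f (in_set_type Cy))) by exact: set_valP.
      have : f (in_set_type Cx) = f (in_set_type Cy).
        by apply: val_inj; move: x0 y0; rewrite /= !set_valE => -> ->.
      by move=> /(can_inj fK) /(congr1 val) /=.
    by right; exact: iso (esym yn).
  by left; exact: iso (esym xn).
move=> zn.
(* The interval isolates the term of index n in the sequence. *)
pose J := [set t : R | (n%:R + 3 / 2)^-1 < t < (n%:R + 1 / 2)^-1].
have n0 : 0 <= n%:R :> R by [].
have JP t : A t -> J t -> t = n.+1%:R^-1.
  move=> [->|[m _ <-]]; rewrite /J /=.
    by rewrite invr_lt0 => /andP[]; lra.
  have m0 : 0 <= m%:R :> R by [].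
  rewrite !ltf_pV2 ?posrE; try lra.
  move=> /andP[h1 h2]; congr (_^-1); congr (_%:R); congr (_.+1).
  rewrite -natr1 in h1 h2.
  have mn : (m < n.+1)%N by rewrite -(ltr_nat R) -natr1; lra.
  have nm : (n < m.+1)%N by rewrite -(ltr_nat R) -natr1; lra.
  by apply/eqP; rewrite eqn_leq -ltnS mn -ltnS nm.
have : open ((set_val \o f) @^-1` J).
  apply: open_comp; last exact: open_oo.
  by move=> w _; exact: continuous_comp (cf w) (@continuous_set_val _ _ _).
move=> [B oB BJ].
rewrite (_ : C `\ z = C `&` ~` B); first by apply: closedI => //; exact: open_closedC.
have BE w (Cw : C w) : B w <-> J (set_val (f (in_set_type Cw))).
  by rewrite -[J _]/(((set_val \o f) @^-1` J) _) -BJ.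
apply/seteqP; split=> w [Cw nw]; split => //.
  move=> /(BE _ Cw) Jw; apply: nw.
  have : f (in_set_type Cw) = f (in_set_type Cz).
    apply: val_inj; rewrite /= -!set_valE zn; apply: JP => //; exact: set_valP.
  by move=> /(can_inj fK) /(congr1 val).
move=> wz; apply: nw; apply/(BE _ Cw).
rewrite (_ : in_set_type Cw = in_set_type Cz); last exact: val_inj.
have n1 : n.+1%:R = n%:R + 1 :> R by rewrite natr1.
by rewrite zn /J /= !ltf_pV2 ?posrE ?n1; lra.
Qed.

Theorem proposition11 (R : realType) (X : topologicalType)
    (compactX : compact [set: X]) (metrizableX : metrizable R X)
    (denseO : dense (arc_points R X)) :
  let C : set X := ~` arc_points R X in
  let S : set X := circle_points R X in
  [/\ clopen_base C, finite_set (components (~` S)) &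
      is_subset1 (closure S `&` C)]
  \/ (convergent_sequence R C /\ is_subset1 (closure S `&` C)) ->
  (forall d : X -> X -> R, compatible_metric d -> tau_kC d C = tau_k X)
  /\ minimal_group_topology (tau_k X).
Proof.
move=> C S cases.
have S1 : is_subset1 (closure S `&` C) by case: cases => [[]|[]].
have sep (d : X -> X -> R) : compatible_metric d ->
    forall x y, C x -> C y -> x <> y -> separated_points (d := d) x y.
  move=> md x y Cx Cy xy; have yx : y <> x by move=> /esym.
  case: cases => [[base fin _]|[seqC _]].
    have [nSx|nSy] : ~ closure S x \/ ~ closure S y.
      by apply/not_andP => -[Sx Sy]; apply: xy; exact: S1.
      exact: (separated_component md compactX denseO base fin Cx Cy xy nSx).
    apply: separated_points_sym.
    exact: (separated_component md compactX denseO base fin Cy Cx yx nSy).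
  have cC : closed C by apply: open_closedC; exact: open_arc_points.
  have [ix|iy] := convergent_sequence_isolated cC seqC Cx Cy xy.
    exact: (separated_isolated md compactX denseO S1 Cx Cy xy ix).
  apply: separated_points_sym.
  exact: (separated_isolated md compactX denseO S1 Cy Cx yx iy).
have unif (d : X -> X -> R) (md : compatible_metric d) :=
  uniform_of_separated md compactX S1 (sep d md).
split=> [d md|]; first exact: (tau_kC_eq md compactX (unif d md)).
have [d md] := metrizableX.
exact: (tau_k_minimal md compactX (unif d md)).
Qed.
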